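(* Let $r\geqslant3$ and let $\mathcal L$ be the class of $r$th order linear ODEs $x^{(r)}+a_{r-1}(t)x^{(r-1)}+\dots+a_1(t)x^{(1)}+a_0(t)x=b(t)$ with arbitrary smooth functions $a_{r-1},\dots,a_0,b$ of $t$. The equivalence group $G^\sim$ of $\mathcal L$ consists of the transformations whose projections to the variable space have the form $$\tilde t=T(t),\quad \tilde x=X_1(t)x+X_0(t),$$ where $T$, $X_1$ and $X_0$ are arbitrary smooth functions of $t$ with $T_tX_1\ne0$. This group generates the entire equivalence groupoid of the class $\mathcal L$, i.e., the class $\mathcal L$ is normalized.
   Context: The underlying field $\mathbb F$ is $\mathbb R$ or $\mathbb C$; all variables, functions and constants are real or complex, respectively. $x=x(t)$ is the unknown function, $x^{(k)}=d^kx/dt^k$; subscripts $t$, $x$ of functions denote derivatives. Everything is local: functions and transformations are smooth and considered on suitable open domains. A point transformation is a transformation $\tilde t=T(t,x)$, $\tilde x=X(t,x)$ with nonvanishing Jacobian $\partial(T,X)/\partial(t,x)$; it acts on ODEs via prolongation to derivatives. The arbitrary elements of a class of ODEs are the functions (coefficients, right-hand side) parameterizing it. An admissible transformation of a class is a triple $(\mathcal E,\tilde{\mathcal E},\mathcal T)$, where $\mathcal E$ and $\tilde{\mathcal E}$ are equations of the class and $\mathcal T$ (the transformational part) is a point transformation mapping $\mathcal E$ to $\tilde{\mathcal E}$. The equivalence groupoid of the class is the set of all its admissible transformations with composition. The (usual) equivalence (pseudo)group of the class consists of the point transformations in the joint space of $t$, $x$, the derivatives of $x$ and the arbitrary elements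 that are consistent with the contact structure (the components for derivatives are obtained by prolongation), are projectable to the variable space, i.e. the $(t,x)$-space (the components for $t$ and $x$ depend only on $(t,x)$), and map every equation of the class to an equation of the class. An equivalence transformation generates the admissible transformations $(\mathcal E,\tilde{\mathcal E},\mathcal T)$ in which $\mathcal T$ is its projection to the $(t,x)$-space, $\mathcal E$ is any equation of the class and $\tilde{\mathcal E}$ is the image of $\mathcal E$. A class is normalized if its equivalence group generates its entire equivalence groupoid. *)

(* Defs.v *)
From HB Require Import structures.
From mathcomp Require Import all_boot all_order all_algebra.
From mathcomp Require Import all_classical all_reals all_analysis.
From mathcomp Require Import complex.
Set Implicit Arguments.
Unset Strict Implicit.
Unset Printing Implicit Defensive.
Import Order.TTheory GRing.Theory Num.Theory.
Import numFieldNormedType.Exports.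
Local Open Scope ring_scope.
Local Open Scope classical_set_scope.

Inductive real_or_complex (R : realType) : numFieldType -> Prop :=
| RealField : real_or_complex R R
| ComplexField : real_or_complex R (complex R).

Section Smoothness.
Variable K : numFieldType.

Definition partial (V : normedModType K) n (i : 'I_n) (f : 'rV[K]_n -> V) :
    'rV[K]_n -> V :=
  fun p => 'D_(delta_mx 0 i) f p.

(* All iterated partial derivatives are Frechet differentiable on U: this is
   C^oo for real scalars and holomorphy for complex scalars. *)
Definition smooth_on (V : normedModType K) n (U : set 'rV[K]_n)
    (f : 'rV[K]_n -> V) : Prop :=
  forall (s : seq 'I_n) (p : 'rV[K]_n),
    U p -> differentiable (foldr (@partial V n) f s) p.

Definition smooth1_on (I : set K) (f : K -> K) : Prop :=
  forall (k : nat) (t : K), I t -> derivable (derive1n k f) t 1.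

(* A smooth map with nonvanishing Jacobian on an open domain; its values
   outside the domain are irrelevant. *)
Record transformation (n : nat) := Transformation {
  tr_dom : set 'rV[K]_n;
  tr_map :> 'rV[K]_n -> 'rV[K]_n;
  tr_dom_open : open tr_dom;
  tr_smooth : smooth_on tr_dom tr_map;
  tr_jacobian : forall p, tr_dom p -> \det (jacobian tr_map p) != 0 }.

End Smoothness.

Section LinearODE.
Variables (K : numFieldType) (r : nat).

(* Points (t, x) of the variable space have index 0 for t and 1 for x. *)
Local Notation point := 'rV[K]_2.
(* Jets (t, x, x^(1), ..., x^(r)): index 0 for t, index k.+1 for x^(k). *)
Local Notation jet := 'rV[K]_(r.+2).

Definition tvar (p : point) : K := p 0 0.
Definition xvar (p : point) : K := p 0 1.

Definition jet_t (j : jet) : K := j 0 0.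
Definition jet_x (k : nat) (j : jet) : K := j 0 (inord k.+1).
Definition base (j : jet) : point := \row_(i < 2) j 0 (inord i).

(* D = d/dt + x^(1) d/dx + ... + x^(r) d/dx^(r-1); the truncation is harmless
   on functions that do not depend on x^(r). *)
Definition total_derivative (f : jet -> K) : jet -> K := fun j =>
  partial ord0 f j + \sum_(k < r) jet_x k.+1 j * partial (inord k.+1) f j.

Section Prolongation.
Variable T : transformation K 2.

Definition new_t (j : jet) : K := tvar (T (base j)).

(* The open set of jets on which the prolongation of T is defined. *)
Definition prolong_dom (j : jet) : Prop :=
  tr_dom T (base j) /\ total_derivative new_t j != 0.

Fixpoint new_x (k : nat) : jet -> K :=
  if k is k'.+1
  then fun j => total_derivative (new_x k') j / total_derivative new_t j
  else fun j => xvar (T (base j)).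

Definition prolong (j : jet) : jet :=
  \row_(i < r.+2) (if val i is k.+1 then new_x k j else new_t j).

End Prolongation.

(* x^(r) + a_(r-1)(t) x^(r-1) + ... + a_0(t) x = b(t), for t in an open set *)
Record linear_ode := LinearODE {
  ode_dom : set K;
  ode_a : 'I_r -> K -> K;
  ode_b : K -> K;
  ode_dom_open : open ode_dom;
  ode_a_smooth : forall i, smooth1_on ode_dom (ode_a i);
  ode_b_smooth : smooth1_on ode_dom ode_b }.

Definition satisfies (E : linear_ode) (j : jet) : Prop :=
  jet_x r j + \sum_(i < r) ode_a E i (jet_t j) * jet_x i j
    = ode_b E (jet_t j).

(* T maps E to E', over the part U of the domain of T. *)
Definition maps_ode (T : transformation K 2) (U : set point)
    (E E' : linear_ode) : Prop :=
  (forall p, U p -> ode_dom E (tvar p) /\ ode_dom E' (tvar (T p))) /\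
  (forall j, U (base j) -> prolong_dom T j ->
     (satisfies E j <-> satisfies E' (prolong T j))).

Definition admissible (E E' : linear_ode) (T : transformation K 2) : Prop :=
  maps_ode T (tr_dom T) E E'.

(* The joint space has coordinates (jet, (a_0, ..., a_(r-1), b)). *)
Definition arbitrary_elements (E : linear_ode) (t : K) : 'rV[K]_(r + 1) :=
  row_mx (\row_(i < r) ode_a E i t) (ode_b E t)%:M.

Local Notation joint_transformation := (transformation K (r.+2 + (r + 1))).

(* Phi is projectable to the variable space with projection T and its
   components for derivatives are the prolongation of T.  Phi is defined over
   the whole domain of that prolongation and for all values of the arbitrary
   elements, since it has to act on every equation of the class. *)
Definition projects_to (Phi : joint_transformation) (T : transformation K 2) :
    Prop :=
  (forall z, tr_dom Phi z <-> prolong_dom T (lsubmx z)) /\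
  (forall z, tr_dom Phi z -> lsubmx (Phi z) = prolong T (lsubmx z)).

(* E' is the image of E under Phi over U: the equation E is mapped to E', and
   the graph of the arbitrary elements of E to that of those of E'. *)
Definition maps_equation (Phi : joint_transformation)
    (T : transformation K 2) (U : set point) (E E' : linear_ode) : Prop :=
  maps_ode T U E E' /\
  (forall j, U (base j) -> prolong_dom T j ->
     rsubmx (Phi (row_mx j (arbitrary_elements E (jet_t j))))
       = arbitrary_elements E' (new_t T j)).

(* The image of an equation is required to exist locally: since the domain of
   T is arbitrary and T need not be injective, distinct points of the domain
   over the same t, or with the same image, may call for different images. *)
Definition equivalence_transformation (Phi : joint_transformation) : Prop :=
  exists T : transformation K 2, projects_to Phi T /\
    forall (E : linear_ode) (p : point), tr_dom T p -> ode_dom E (tvar p) ->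
      exists (U : set point) (E' : linear_ode),
        [/\ open U, U p, U `<=` tr_dom T & maps_equation Phi T U E E'].

(* Every admissible transformation is generated by an equivalence
   transformation. *)
Definition normalized : Prop :=
  forall (E E' : linear_ode) (T : transformation K 2), admissible E E' T ->
    exists Phi : joint_transformation,
      [/\ equivalence_transformation Phi, projects_to Phi T
        & maps_equation Phi T (tr_dom T) E E'].

End LinearODE.

Arguments projects_to {K r} Phi T.
Arguments equivalence_transformation {K r} Phi.

(* Near each point of its domain, T is of the form
     t' = tau(t),  x' = X1(t) x + X0(t)  with  tau'(t) X1(t) <> 0. *)
Definition fibre_affine (K : numFieldType) (T : transformation K 2) : Prop :=
  forall p0 : 'rV[K]_2, tr_dom T p0 ->
    exists (U : set 'rV[K]_2) (I : set K) (tau X1 X0 : K -> K),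
      [/\ open U /\ U p0, open I,
          [/\ smooth1_on I tau, smooth1_on I X1 & smooth1_on I X0],
          forall t, I t -> derive1 tau t * X1 t != 0
        & forall p, U p ->
            [/\ I (tvar p), tvar (T p) = tau (tvar p)
              & xvar (T p) = X1 (tvar p) * xvar p + X0 (tvar p)]].

(* Main.v *)
(** Let (t, x) -> (T, X) map a linear equation to a linear equation.  If T_x <> 0 at a
    point, consider jets over it with x' -> - T_t / T_x.  Along them D T -> 0 and the
    r-th transformed derivative blows up like (D T)^(1 - 2r), faster than the lower
    ones, unless D D T = 0; but x'' is free on the equation because r >= 3, so D D T
    can be normalized to 1, and the target equation cannot hold.  Hence T_x = 0, and
    then the k-th transformed derivative is
      X_x T_t^(-k) x^(k) + L_k x^(k-1) + terms of lower order,
    with L_k affine in x' and with slope k X_xx T_t^(-k).  The mixed second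
    difference of the target equation in x' and x^(r-1) yields X_xx = 0.

    Conversely, if x is transformed affinely, then so are the jets over each t,
    by a triangular matrix with entries c_ki(t).  The coefficients of the image
    equation solve a' C + c = c_rr a with C = (c_ki), k, i < r, which defines the
    lift of the transformation; they are functions of T(t), hence of a local
    inverse of T, and no other coefficients are possible since x, ..., x^(r-1) are
    independent on the equation. *)

(* The target equation is used over one point p at a time. The new time is then constant, hence so
   are the coefficients of the target equation, and only the dependence on x', ..., x^(r) matters.
   The exponent 2r - 1 arises because D T itself involves x': each further application of D / D T
   divides by D T and also differentiates a power of 1 / D T, so the pole order grows by 2.
   Multiplying by (D T)^(2r - 1) yields a function that is smooth across D T = 0, so that the
   blow-up becomes a contradiction with continuity and needs no estimates. The condition r >= 3 has
   a second use: x' and x^(r-1) must be different coordinates for the mixed difference. The lift has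
   to be one map on its whole domain, although the functions tau, X1, X0 exist only locally and may
   differ from place to place. Hence c_ki is encoded as the derivative of the k-th transformed
   derivative by x^(i), which refers to T alone. Real and complex scalars are treated together: a
   mean value inequality over K gives constancy on balls and the local inverse. *)
From HB Require Import structures.
Require Import Defs.
From mathcomp Require Import all_boot all_order all_algebra.
From mathcomp Require Import all_classical all_reals all_analysis.
From mathcomp Require Import complex.
From mathcomp Require Import ring.
Set Implicit Arguments.
Unset Strict Implicit.
Unset Printing Implicit Defensive.
Import Order.TTheory GRing.Theory Num.Theory.
Import numFieldNormedType.Exports.
Local Open Scope ring_scope.
Local Open Scope classical_set_scope.

(** * Differentiability of finite order *)

Section Ck.
Variable K : numFieldType.

(** Differentiability depends on the germ only: [g - f] vanishes near [p], so the zero map is its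
    differential, with a remainder that is exactly zero near [p]. *)
Lemma near_differentiable (V W : normedModType K) (f g : V -> W) (p : V) :
  {near p, f =1 g} -> differentiable f p -> differentiable g p.
Proof.
move=> fg df; rewrite (_ : g = f + (g - f)); last first.
  by apply/funext => x /=; rewrite !fctE addrC subrK.
apply: differentiableD => //; set h := g - f.
have hp : h p = 0 by rewrite /h !fctE (nbhs_singleton fg) subrr.
have E : h \o shift p = cst (h p) + (\0 : {linear V -> W}) +o_ 0 id.
  apply/eqaddoP => _/posnumP[e]; near=> x.
  rewrite !fctE /= hp addr0 subr0 /h !fctE (_ : g _ = f (x + p)) ?subrr ?normr0 ?mulr_ge0//.
  apply/esym; near: x; move: fg; rewrite (near_shift 0 p) /=; apply: filterS => x.
  by rewrite /= subr0.
have dh : 'd h p = (\0 : {linear V -> W}) :> (V -> W).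
  by apply: diff_unique => //; exact: cst_continuous.
apply/diff_locallyP; rewrite dh; split => //; exact: cst_continuous.
Unshelve. all: by end_near. Qed.

(* Off by one: Ck 0 is differentiability, not continuity. *)
Fixpoint Ck (V : normedModType K) n (m : nat) (U : set 'rV[K]_n) (f : 'rV[K]_n -> V) : Prop :=
  (forall p, U p -> differentiable f p) /\
  (if m is m'.+1 then forall i, Ck m' U (partial i f) else True).

Section fixV.
Variables (V : normedModType K) (n : nat) (U : set 'rV[K]_n).
Implicit Types f g : 'rV[K]_n -> V.

Lemma Ck_diff m f p : Ck m U f -> U p -> differentiable f p.
Proof. by case: m => [|m] [+ _]; apply. Qed.

Lemma CkS m f : Ck m.+1 U f -> Ck m U f.
Proof.
elim: m f => [|m IH] f [df dpf]; split=> // i.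
by apply: IH; exact: dpf.
Qed.

(** Products, inverses and compositions are treated by induction on the order, since their
    derivatives contain expressions of the same kind. A word of partial derivatives is less
    suitable, because the Leibniz rule turns it into a sum over many words. *)
Lemma smooth_onP f : smooth_on U f <-> forall m, Ck m U f.
Proof.
split=> [sf m|Cf s p Up].
  elim: m f sf => [|m IH] f sf; split => //; try exact: (sf [::]).
  (* [foldr] applies the last letter of the word first, hence the [rcons]. *)
  by move=> i; apply: IH => s p Up; have := sf (rcons s i) p Up; rewrite foldr_rcons.
have : Ck (size s) U f by [].
elim/last_ind: s f {Cf} => [|s i IH] f /=; first by move=> [+ _]; exact.
by rewrite size_rcons foldr_rcons => -[_ /(_ i)]; exact: IH.
Qed.

Hypothesis oU : open U.

Lemma partial_eq_on f g i : (forall p, U p -> f p = g p) ->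
  forall p, U p -> partial i f p = partial i g p.
Proof.
move=> fg p Up; apply: near_eq_derive.
by apply: filterS (open_nbhs_nbhs (conj oU Up)) => x; exact: fg.
Qed.

Lemma Ck_eq m f g : (forall p, U p -> f p = g p) -> Ck m U f -> Ck m U g.
Proof.
elim: m f g => [|m IH] f g fg [df dpf]; split=> //; try (
  move=> p Up; apply: near_differentiable (df _ Up);
  by apply: filterS (open_nbhs_nbhs (conj oU Up)) => x; exact: fg).
by move=> i; apply: IH (dpf i); exact: partial_eq_on.
Qed.

Lemma smooth_on_eq f g : (forall p, U p -> f p = g p) -> smooth_on U f -> smooth_on U g.
Proof. by move=> fg /smooth_onP sf; apply/smooth_onP => m; apply: Ck_eq (sf m). Qed.

(** Allows a partial derivative to be replaced by a formula that is correct on [U] only, as the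
    differentiation rules provide it. *)
Lemma CkP m f : (forall p, U p -> differentiable f p) ->
  (forall i, exists2 g, (forall p, U p -> g p = partial i f p) & Ck m U g) -> Ck m.+1 U f.
Proof. by move=> df dpf; split=> // i; have [g gE /Ck_eq] := dpf i; exact. Qed.

Lemma Ck_cst m (c : V) : Ck m U (cst c).
Proof.
elim: m c => [|m IH] c; first by split => // p _; exact: differentiable_cst.
apply: CkP => [p _|i]; first exact: differentiable_cst.
by exists (cst 0) => // p Up; rewrite /partial derive_cst.
Qed.

Lemma Ck_add m f g : Ck m U f -> Ck m U g -> Ck m U (f \+ g).
Proof.
elim: m f g => [|m IH] f g Cf Cg.
  by split => // p Up; apply: differentiableD; [apply: Ck_diff Cf _|apply: Ck_diff Cg _].
apply: CkP => [p Up|i].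
  by apply: differentiableD; [apply: Ck_diff Cf _|apply: Ck_diff Cg _].
exists (partial i f \+ partial i g); last by apply: IH; [apply Cf|apply Cg].
move=> p Up; rewrite /partial deriveD //; apply: diff_derivable.
  exact: Ck_diff Cf _.
exact: Ck_diff Cg _.
Qed.

End fixV.

Section scalar.
Variables (n : nat) (U : set 'rV[K]_n).
Hypothesis oU : open U.
Implicit Types f g : 'rV[K]_n -> K.

Lemma Ck_mul m f g : Ck m U f -> Ck m U g -> Ck m U (f \* g).
Proof.
elim: m f g => [|m IH] f g Cf Cg.
  by split => // p Up; apply: differentiableM; [apply: Ck_diff Cf _|apply: Ck_diff Cg _].
have df p : U p -> differentiable f p by exact: Ck_diff Cf.
have dg p : U p -> differentiable g p by exact: Ck_diff Cg.
apply: CkP => // [p Up|i]; first by apply: differentiableM; [exact: df|exact: dg].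
exists (f \* partial i g \+ g \* partial i f).
  move=> p Up; rewrite /partial deriveM //; apply: diff_derivable; [exact: df|exact: dg].
by apply: Ck_add => //; apply: IH; try (by apply: CkS); [apply Cg|apply Cf].
Qed.

Lemma Ck_opp m f : Ck m U f -> Ck m U (fun p => - f p).
Proof.
move=> Cf; apply: (Ck_eq oU (f := cst (-1) \* f)); last by apply: Ck_mul => //; exact: Ck_cst.
by move=> p Up /=; rewrite mulN1r.
Qed.

Lemma Ck_sub m f g : Ck m U f -> Ck m U g -> Ck m U (f \- g).
Proof. by move=> Cf Cg; apply: Ck_add => //; exact: Ck_opp. Qed.

Lemma Ck_inv m f : (forall p, U p -> f p != 0) -> Ck m U f -> Ck m U (fun p => (f p)^-1).
Proof.
move=> f0; elim: m => [|m IH] Cf.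
  by split => // p Up; apply: differentiableV; [apply: Ck_diff Cf _|exact: f0].
have df p : U p -> differentiable f p by exact: Ck_diff Cf.
(* The derivative of 1/f is a partial derivative of f times -(1/f)^2, so order m for 1/f yields
   order m + 1. *)
have CV := IH (CkS Cf).
apply: CkP => // [p Up|i]; first by apply: differentiableV; [exact: df|exact: f0].
exists (fun p => - ((f p)^-1 * ((f p)^-1 * partial i f p))).
  move=> p Up; rewrite /partial deriveV; [|exact: f0|exact/diff_derivable/df].
  by rewrite /GRing.scale /= -exprVn expr2 mulNr mulrA.
apply: Ck_opp; apply: Ck_mul => //; apply: Ck_mul => //; apply Cf.
Qed.

Lemma Ck_sum m (I : Type) (s : seq I) (P : pred I) (F : I -> 'rV[K]_n -> K) :
  (forall i, P i -> Ck m U (F i)) -> Ck m U (fun p => \sum_(i <- s | P i) F i p).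
Proof.
move=> CF; elim: s => [|i s IH].
  by apply: (Ck_eq oU (f := cst 0)) => [p _|]; [rewrite big_nil|exact: Ck_cst].
have [Pi|Pi] := boolP (P i).
  apply: (Ck_eq oU (f := F i \+ (fun p => \sum_(i <- s | P i) F i p))).
    by move=> p _; rewrite big_cons Pi.
  by apply: Ck_add => //; exact: CF.
by apply: (Ck_eq oU (f := fun p => \sum_(i <- s | P i) F i p)) => // p _;
  rewrite big_cons (negbTE Pi).
Qed.

Lemma Ck_prod m (I : Type) (s : seq I) (P : pred I) (F : I -> 'rV[K]_n -> K) :
  (forall i, P i -> Ck m U (F i)) -> Ck m U (fun p => \prod_(i <- s | P i) F i p).
Proof.
move=> CF; elim: s => [|i s IH].
  by apply: (Ck_eq oU (f := cst (1 : K))) => [p _|]; [rewrite big_nil|exact: Ck_cst].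
have [Pi|Pi] := boolP (P i).
  apply: (Ck_eq oU (f := F i \* (fun p => \prod_(i <- s | P i) F i p))).
    by move=> p _; rewrite big_cons Pi.
  by apply: Ck_mul => //; exact: CF.
by apply: (Ck_eq oU (f := fun p => \prod_(i <- s | P i) F i p)) => // p _;
  rewrite big_cons (negbTE Pi).
Qed.

Lemma Ck_det m q (M : 'rV[K]_n -> 'M[K]_q) :
  (forall i j, Ck m U (fun p => M p i j)) -> Ck m U (fun p => \det (M p)).
Proof.
move=> CM; rewrite /determinant; apply: Ck_sum => s _.
by apply: Ck_mul; [exact: Ck_cst|apply: Ck_prod => i _; exact: CM].
Qed.

Lemma partial_coord (k i : 'I_n) (p : 'rV[K]_n) :
  partial i (fun q : 'rV[K]_n => q 0 k) p = (i == k)%:R.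
Proof.
rewrite /partial deriveE; last exact: differentiable_coord.
pose c := fun q : 'rV[K]_n => q 0 k.
have cl : linear c by move=> a u v; rewrite /c !mxE.
pose cL : {linear 'rV[K]_n -> K} := HB.pack c (GRing.isLinear.Build _ _ _ _ _ cl).
rewrite (_ : (fun q : 'rV_n => q 0 k) = cL) // diff_lin; last exact: coord_continuous.
by rewrite /cL /= /c mxE eqxx eq_sym.
Qed.

Lemma Ck_coord m (k : 'I_n) : Ck m U (fun q : 'rV[K]_n => q 0 k).
Proof.
case: m => [|m]; first by split => // p _; exact: differentiable_coord.
apply: CkP => // [p _|i]; first exact: differentiable_coord.
by exists (cst (i == k)%:R); [move=> p _; rewrite partial_coord|exact: Ck_cst].
Qed.

Lemma differentiable_rV (W : normedModType K) (m : nat) (f : W -> 'rV[K]_m) p :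
  (forall k, differentiable (fun q => f q 0 k) p) -> differentiable f p.
Proof.
move=> df; rewrite (_ : f = \sum_(k < m) (fun q => f q 0 k *: delta_mx 0 k)); last first.
  apply/funext => q; rewrite fct_sumE [LHS]row_sum_delta //.
by apply: differentiable_sum => k; exact: differentiableZl.
Qed.

Lemma differentiable_entry (m : nat) (f : 'rV[K]_n -> 'rV[K]_m) p k :
  differentiable f p -> differentiable (fun q => f q 0 k) p.
Proof.
move=> df; rewrite (_ : (fun q => f q 0 k) = (fun r : 'rV[K]_m => r 0 k) \o f) //.
by apply: differentiable_comp => //; exact: differentiable_coord.
Qed.

Lemma derive_rV (m : nat) (f : 'rV[K]_n -> 'rV[K]_m) p v k :
  differentiable f p -> ('D_v f p) 0 k = 'D_v (fun q => f q 0 k) p.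
Proof.
move=> df; pose c := fun q : 'rV[K]_m => q 0 k.
have cl : linear c by move=> a u w; rewrite /c !mxE.
pose cL : {linear 'rV[K]_m -> K} := HB.pack c (GRing.isLinear.Build _ _ _ _ _ cl).
have cc : continuous cL by exact: coord_continuous.
rewrite (_ : (fun q => f q 0 k) = cL \o f) // !deriveE //; last first.
  by apply: differentiable_comp => //; exact: differentiable_coord.
have dc : differentiable cL (f p) by exact: differentiable_coord.
by have /(congr1 (@^~ v)) := diff_comp df dc; rewrite (diff_lin _ cc) => ->.
Qed.

Lemma derive_partial f p v : differentiable f p ->
  'D_v f p = \sum_i v 0 i * partial i f p.
Proof.
move=> df; rewrite deriveE // {1}[v]row_sum_delta linear_sum; apply: eq_bigr => i _.
by rewrite linearZ /= /partial deriveE.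
Qed.

End scalar.

Lemma Ck_rVP n (U : set 'rV[K]_n) (oU : open U) m q (f : 'rV[K]_n -> 'rV[K]_q) :
  Ck m U f <-> forall k, Ck m U (fun p => f p 0 k).
Proof.
split=> Cf.
  move=> k; elim: m f Cf => [|m IH] f Cf.
    by split => // p Up; apply: differentiable_entry; exact: Ck_diff Cf _.
  apply: CkP => // [p Up|i].
    by apply: differentiable_entry; exact: Ck_diff Cf _.
  exists (fun p => (partial i f p) 0 k); last by apply: IH; apply Cf.
  by move=> p Up; rewrite /partial derive_rV //; exact: Ck_diff Cf _.
elim: m f Cf => [|m IH] f Cf.
  by split => // p Up; apply: differentiable_rV => k; exact: Ck_diff (Cf k) _.
have df p : U p -> differentiable f p.
  by move=> Up; apply: differentiable_rV => k; exact: Ck_diff (Cf k) _.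
split=> // i; apply: IH => k.
apply: (Ck_eq oU (f := partial i (fun p => f p 0 k))); last by case: (Cf k) => _; exact.
by move=> p Up; rewrite [in RHS]/partial derive_rV //; exact: df.
Qed.

Lemma partial_comp n q (F : 'rV[K]_q -> K) (g : 'rV[K]_n -> 'rV[K]_q) p i :
  differentiable g p -> differentiable F (g p) ->
  partial i (F \o g) p = \sum_k partial i (fun p => g p 0 k) p * partial k F (g p).
Proof.
move=> dg dF; rewrite /partial deriveE; last exact: differentiable_comp.
rewrite diff_comp //= -!deriveE // derive_partial //; apply: eq_bigr => k _.
by rewrite derive_rV.
Qed.

(** The induction generalizes [F], because the chain rule replaces [F] by its partial derivatives
    while the inner map stays the same. *)
Lemma Ck_comp n q (U : set 'rV[K]_n) (W : set 'rV[K]_q) (oU : open U) m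
    (F : 'rV[K]_q -> K) (g : 'rV[K]_n -> 'rV[K]_q) :
  (forall p, U p -> W (g p)) -> Ck m W F -> (forall k, Ck m U (fun p => g p 0 k)) ->
  Ck m U (F \o g).
Proof.
move=> UW; elim: m F => [|m IH] F CF Cg.
  split => // p Up; have Wp := UW _ Up.
  by apply: differentiable_comp; [apply: Ck_diff Up; exact/Ck_rVP|apply: Ck_diff CF _].
have dg p : U p -> differentiable g p by apply: Ck_diff; apply/Ck_rVP => //; exact: Cg.
have dF p : U p -> differentiable F (g p) by move=> Up; apply: Ck_diff CF _; exact: UW.
apply: CkP => // [p Up|i]; first by apply: differentiable_comp; [exact: dg|exact: dF].
exists (fun p => \sum_k partial i (fun p => g p 0 k) p * partial k F (g p)).
  by move=> p Up; rewrite partial_comp //; [exact: dg|exact: dF].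
apply: Ck_sum => // k _; apply: Ck_mul => //; first by case: (Cg k) => _; exact.
by apply: (IH (partial k F)) => [|k']; [case: CF => _; exact|exact: CkS].
Qed.


(** * Smooth functions of one scalar variable *)

Section OneVariable.
Implicit Types (I : set K) (f : K -> K).

Definition line I : set 'rV[K]_1 := [set p | I (p 0 0)].

Lemma open_line I : open I -> open (line I).
Proof.
move=> oI; apply: (@open_comp _ _ (fun p : 'rV[K]_1 => p 0 0)) => // p _.
exact: coord_continuous.
Qed.

Lemma differentiable_line f (p : 'rV[K]_1) :
  differentiable (fun q : 'rV[K]_1 => f (q 0 0)) p <-> derivable f (p 0 0) 1.
Proof.
split=> [df|/derivable1_diffP df].
  apply/derivable1_diffP; pose r := fun t : K => \row_(i < 1) t.
  rewrite (_ : f = (fun q : 'rV_1 => f (q 0 0)) \o r); last first.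
    by apply/funext => t; rewrite /= mxE.
  apply: differentiable_comp; first by apply: differentiable_rV => k;
    rewrite (_ : (fun q => _) = id) //; apply/funext => t; rewrite mxE.
  rewrite (_ : r _ = p) //; apply/rowP => i; by rewrite mxE ord1.
rewrite (_ : (fun q => _) = f \o (fun q : 'rV[K]_1 => q 0 0)) //.
by apply: differentiable_comp => //; exact: differentiable_coord.
Qed.

Lemma partial_line f i :
  partial i (fun q : 'rV[K]_1 => f (q 0 0)) = (fun q => derive1 f (q 0 0)).
Proof.
apply/funext => p; rewrite /partial /derive /derive1.
set a := (fun h : K => _); set b := (fun h : K => _); suff -> : a = b by [].
by apply/funext => h; rewrite /a /b /= !mxE ord1 !eqxx mulr1.
Qed.

(** A scalar variable is read as a row vector with one entry, which transfers the closure properties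
    of [Ck] to [smooth1_on]. *)
Lemma smooth1_onP I f :
  smooth1_on I f <-> forall m, Ck m (line I) (fun p => f (p 0 0)).
Proof.
split=> [sf m|Cf k].
  elim: m f sf => [|m IH] f sf; first by split => // p Ip; apply: (differentiable_line f p).2;
    exact: (sf 0%N).
  split=> [p Ip|i]; first by apply/differentiable_line; exact: (sf 0%N).
  rewrite partial_line; apply: (IH (derive1 f)) => k t It.
  by rewrite -derive1Sn; exact: sf.
elim: k f Cf => [|k IH] f Cf t It.
  suff : derivable f ((\row_(i < 1) t) 0 0) 1 by rewrite mxE.
  by apply/differentiable_line; case: (Cf 0%N) => + _; apply; rewrite /line /= mxE.
rewrite derive1Sn; apply: IH It => m; rewrite -(partial_line f 0).
by case: (Cf m.+1) => _; exact.
Qed.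

Lemma smooth1_comp n I (W : set 'rV[K]_n) (F : 'rV[K]_n -> K) (g : K -> 'rV[K]_n) :
  open I -> (forall t, I t -> W (g t)) -> smooth_on W F ->
  (forall k, smooth1_on I (fun t => g t 0 k)) -> smooth1_on I (F \o g).
Proof.
move=> oI IW /smooth_onP sF sg; apply/smooth1_onP => m.
apply: (@Ck_comp _ _ _ _ (open_line oI) m F (fun p : 'rV_1 => g (p 0 0))) => //.
- by move=> p Ip; exact: IW.
- by move=> k; move/smooth1_onP: (sg k); exact.
Qed.

Lemma smooth1_cst I (c : K) (oI : open I) : smooth1_on I (cst c).
Proof. by apply/smooth1_onP => m; exact: (Ck_cst (open_line oI) m c). Qed.

Lemma smooth1_id I (oI : open I) : smooth1_on I id.
Proof. by apply/smooth1_onP => m; exact: (Ck_coord (open_line oI) m 0). Qed.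

Lemma smooth1_comp1 I J (f g : K -> K) : open I -> open J ->
  (forall t, I t -> J (g t)) -> smooth1_on J f -> smooth1_on I g -> smooth1_on I (f \o g).
Proof.
move=> oI oJ IJ /smooth1_onP sf sg.
rewrite (_ : f \o g = (fun p : 'rV_1 => f (p 0 0)) \o (fun t => \row_(i < 1) g t)); last first.
  by apply/funext => t /=; rewrite mxE.
apply: (@smooth1_comp _ _ (line J)) => //.
- by move=> t It; rewrite /line /= mxE; exact: IJ.
- by apply/smooth_onP => m.
- by move=> k; rewrite (_ : (fun t => _) = g) //; apply/funext => t; rewrite mxE.
Qed.

Lemma smooth1_mul I f g : open I -> smooth1_on I f -> smooth1_on I g -> smooth1_on I (f \* g).
Proof.
move=> oI /smooth1_onP sf /smooth1_onP sg; apply/smooth1_onP => m.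
exact: (Ck_mul (open_line oI) (sf m) (sg m)).
Qed.

Lemma smooth1_add I f g : open I -> smooth1_on I f -> smooth1_on I g -> smooth1_on I (f \+ g).
Proof.
move=> oI /smooth1_onP sf /smooth1_onP sg; apply/smooth1_onP => m.
exact: (Ck_add (open_line oI) (sf m) (sg m)).
Qed.

Lemma smooth1_inv I f : open I -> (forall t, I t -> f t != 0) -> smooth1_on I f ->
  smooth1_on I (fun t => (f t)^-1).
Proof.
move=> oI f0 /smooth1_onP sf; apply/smooth1_onP => m.
by apply: (@Ck_inv _ _ (open_line oI) m (fun p : 'rV_1 => f (p 0 0))) => // p Ip; exact: f0.
Qed.

Lemma smooth1_derive1 I f : smooth1_on I f -> smooth1_on I (derive1 f).
Proof. by move=> sf k t It; rewrite -derive1Sn; exact: sf. Qed.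

Lemma smooth1_eq I f g : open I -> (forall t, I t -> f t = g t) ->
  smooth1_on I f -> smooth1_on I g.
Proof.
move=> oI fg /smooth1_onP sf; apply/smooth1_onP => m.
by apply: (Ck_eq (open_line oI)) (sf m) => p Ip; exact: fg.
Qed.

Lemma smooth1_sub I J f : (forall t, J t -> I t) -> smooth1_on I f -> smooth1_on J f.
Proof. by move=> JI sf k t Jt; apply: sf; exact: JI. Qed.

(** Bootstrapping: s' = 1 / f'(s) inherits the order of differentiability of s, so s gains one
    order. *)
Lemma smooth1_inverse I J (f s : K -> K) : open J ->
  smooth1_on I f -> (forall t, I t -> derive1 f t != 0) -> (forall y, J y -> I (s y)) ->
  (forall y, J y -> is_derive y 1 s (derive1 f (s y))^-1) -> smooth1_on J s.
Proof.
move=> oJ sf f0 JI ds; apply/smooth1_onP; elim=> [|m IH].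
  by split => // p Jp; apply/differentiable_line; have [] := ds _ Jp.
have oL := open_line oJ.
apply: (CkP oL) => [p Jp|i].
  by apply/differentiable_line; have [] := ds _ Jp.
exists (fun p => (derive1 f (s (p 0 0)))^-1).
  by move=> p Jp; rewrite partial_line (derive1E s); have [_ ->] := ds _ Jp.
apply: Ck_inv => // [p Jp|]; first by apply: f0; exact: JI.
have /smooth1_onP/(_ m) Cf := smooth1_derive1 sf.
apply: (Ck_eq oL (f := (fun q : 'rV_1 => derive1 f (q 0 0)) \o (fun p => \row_(i < 1) s (p 0
  0)))).
  by move=> p _ /=; rewrite mxE.
apply: (@Ck_comp _ _ _ (line I) oL m (fun q : 'rV_1 => derive1 f (q 0 0)) (fun p => \row_(i < 1)
  s (p 0 0))) => //.
  by move=> p Jp; rewrite /line /= mxE; exact: JI.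
by move=> k; apply: (Ck_eq oL _ IH) => p _; rewrite mxE.
Qed.

End OneVariable.

End Ck.

(** * Mean value inequality over R and C *)

(* A common interface for R and C; the imaginary part is 0 for R. *)
Record real_form (R : realType) (K : numFieldType) := RealForm {
  rf_inj : {rmorphism R -> K};
  rf_re : {additive K -> R};
  rf_im : {additive K -> R};
  rf_unit : K;
  rf_le : {mono rf_inj : a b / a <= b};
  rf_norm_inj : forall a : R, `|rf_inj a| = rf_inj `|a|;
  rf_scale : forall (a : R) (z : K), rf_re (rf_inj a * z) = a * rf_re z;
  rf_norm_re : forall z : K, rf_inj `|rf_re z| <= `|z|;
  rf_norm_im : forall z : K, rf_inj `|rf_im z| <= `|z|;
  rf_re_norm : forall z : K, rf_inj (rf_re `|z|) = `|z|;
  rf_split : forall z : K, z = rf_inj (rf_re z) + rf_unit * rf_inj (rf_im z) }.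

Lemma real_form_exists (R : realType) (K : numFieldType) (hK : real_or_complex R K) :
  inhabited (real_form R K).
Proof.
case: hK; constructor.
  by refine (@RealForm R R idfun idfun \0 0 _ _ _ _ _ _ _) => //= *;
    rewrite ?normr_id ?normr0 ?mul0r ?addr0.
have rea : additive (@complex.Re R) by move=> [a b] [c d].
have ima : additive (@complex.Im R) by move=> [a b] [c d].
pose re : {additive complex R -> R} := HB.pack (@complex.Re R) (GRing.isAdditive.Build _ _ _ rea).
pose im : {additive complex R -> R} := HB.pack (@complex.Im R) (GRing.isAdditive.Build _ _ _ ima).
refine (@RealForm R (complex R) (real_complex R) re im 'i%C _ _ _ _ _ _ _).
- by move=> a b; rewrite lecE /= eqxx.
- by move=> a; rewrite normc_def /= expr0n addr0 sqrtr_sqr.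
- by move=> a [b c] /=; rewrite mul0r subr0.
- by move=> z; exact: normc_ge_Re.
- move=> [a b] /=; rewrite normc_def /= lecR -sqrtr_sqr ler_wsqrtr // lerDr; exact: sqr_ge0.
- by move=> z; rewrite normc_def.
- by case=> a b /=; apply/eqP; rewrite eq_complex /=; apply/andP; split; apply/eqP;
  rewrite ?(mul0r, mul1r, mulr0, subr0, addr0, add0r, oppr0).
Qed.

Section MeanValue.
Variables (R : realType) (K : numFieldType) (rf : real_form R K).
Local Notation iota := (rf_inj rf).
Local Notation re := (rf_re rf).

Lemma rf_lt : {mono iota : a b / a < b}.
Proof. by move=> a b; rewrite !lt_neqAle rf_le fmorph_eq. Qed.

Lemma inj_re (e : K) : 0 <= e -> iota (re e) = e.
Proof. by move=> e0; rewrite -(ger0_norm e0) rf_re_norm. Qed.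

Lemma le_re z : iota (re z) <= `|z|.
Proof. by apply: le_trans (rf_norm_re rf z); rewrite rf_le ler_norm. Qed.

Lemma inj_continuous : continuous iota.
Proof.
move=> a; apply/cvgrPdist_lt => e e0; have re0 : 0 < re e.
  by rewrite -rf_lt rmorph0 inj_re // ltW.
near=> b; rewrite -rmorphB rf_norm_inj -(inj_re (ltW e0)) rf_lt.
by near: b; apply: cvgr_dist_lt.
Unshelve. all: by end_near. Qed.

Lemma re_continuous : continuous re.
Proof.
move=> a; apply/(@cvgrPdist_lt _ _ _ (nbhs a)) => e e0;
  have re0 : 0 < iota e by rewrite -(rmorph0 iota) rf_lt.
near=> b; rewrite -raddfB -rf_lt; apply: le_lt_trans (rf_norm_re rf _) _.
by near: b; apply: cvgr_dist_lt.
Unshelve. all: by end_near. Qed.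

Lemma inj_dnbhs0 : iota x @[x --> 0^'] --> (0 : K)^'.
Proof.
move=> A A0; change (\forall x \near (0 : R), x != 0 -> A (iota x)).
have A0' : \forall y \near iota 0, y != 0 -> A y by rewrite rmorph0; exact: A0.
have H : \forall x \near (0 : R), iota x != 0 -> A (iota x) := inj_continuous A0'.
apply: filterS H => x /= H xn0; apply: H.
by rewrite fmorph_eq0.
Qed.

(** Reduction to one real variable: a real linear functional of [f] along a segment is a function to
    which the real mean value theorem applies. *)
Lemma is_derive_re (f : K -> K) (a v u : K) (s : R) :
  derivable f (a + iota s * v) 1 ->
  is_derive s 1 (fun s : R => re (u * f (a + iota s * v)))
    (re (u * (derive1 f (a + iota s * v) * v))).
Proof.
set z := a + iota s * v => /derivable1_diffP df.
have D : 'D_v f z = derive1 f z * v.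
  by rewrite deriveE // diff1E // mulrC.
have fD := (@diff_derivable _ _ _ _ _ v df).
have cD : h^-1 *: ((f \o shift z) (h *: v) - f z) @[h --> 0^'] --> derive1 f z * v.
  by rewrite -D; exact: fD.
have cv : h^-1 *: (((fun s : R => re (u * f (a + iota s * v))) \o shift s) (h *: 1) - re (u * f
  z))
      @[h --> 0^'] --> re (u * (derive1 f z * v)).
  (* The real increment enters [f] through [iota], and [re] is linear over the reals, so the real
     difference quotient is [re] of the one over [K]. *)
  apply: (@cvg_trans _ (re (u * ((iota h)^-1 *: ((f \o shift z) (iota h *: v) - f z))) @[h -->
    0^'])).
    apply: near_eq_cvg; near=> h; rewrite -fmorphV /= /GRing.scale /= mulrCA rf_scale.
    rewrite mulrBr raddfB mulr1 /z rmorphD mulrDl; congr (_ * (re (u * f _) - _)).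
    by rewrite addrCA.
  apply: continuous_cvg; first exact: re_continuous.
  apply: cvgM; first exact: cvg_cst.
  exact: (cvg_comp _ _ inj_dnbhs0 cD).
apply: DeriveDef; first by apply/cvg_ex; eexists; exact: cv.
exact: cvg_lim cv.
Unshelve. all: by end_near. Qed.

Lemma ball_segment (c a b e : K) (s : R) : 0 <= s -> s <= 1 -> ball c e a -> ball c e b ->
  ball c e (a + iota s * (b - a)).
Proof.
move=> s0 s1; rewrite -!ball_normE /= => ca cb.
have is0 : 0 <= iota s by rewrite -(rmorph0 iota) rf_le.
have is1 : 0 <= 1 - iota s by rewrite subr_ge0 -(rmorph1 iota) rf_le.
have E (x : K) : c - (a + x * (b - a)) = (1 - x) * (c - a) + x * (c - b) by ring.
rewrite E.
apply: le_lt_trans (ler_normD _ _) _; rewrite !normrM (ger0_norm is0) (ger0_norm is1).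
(* Strictness comes from the endpoint [b], whose weight is [s]; hence s = 0 is a separate case. *)
have [s00|sn0] := eqVneq s 0; first by rewrite s00 rmorph0 subr0 mul1r mul0r addr0; exact: ca.
have E' (x : K) : e = (1 - x) * e + x * e by ring.
rewrite [ltRHS](E' (iota s)).
apply: ler_ltD; first by rewrite ler_wpM2l // ltW.
by rewrite ltr_pM2l // lt_def is0 fmorph_eq0 sn0.
Qed.

Lemma mean_value (f : K -> K) (c e M : K) :
  (forall w, ball c e w -> derivable f w 1) ->
  (forall w, ball c e w -> `|derive1 f w| <= M) ->
  forall a b, ball c e a -> ball c e b -> `|f b - f a| <= M * `|b - a|.
Proof.
move=> df fM a b ca cb; set w := f b - f a; set v := b - a.
have M0 : 0 <= M by apply: le_trans (fM _ ca).
have [->|w0] := eqVneq w 0; first by rewrite normr0 mulr_ge0.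
(* A factor of modulus 1 that rotates the increment onto the positive real axis, so that its real
   part is its modulus. *)
pose u := `|w| / w; have uw : u * w = `|w| by rewrite mulfVK.
have u1 : `|u| = 1 by rewrite normrM normfV normr_id mulfV // normr_eq0.
pose g (s : R) := re (u * f (a + iota s * v)).
have bs (s : R) : 0 <= s -> s <= 1 -> ball c e (a + iota s * v) by move=> *; exact: ball_segment.
have dg (s : R) : 0 <= s -> s <= 1 -> is_derive s 1 g (re (u * (derive1 f (a + iota s * v) * v))).
  by move=> s0 s1; apply: is_derive_re; apply: df; exact: bs.
have [||t /[!in_itv]/= /andP[t0 t1]] := @MVT R g (fun s => re (u * (derive1 f (a + iota s * v) *
  v))) 0 1 ltr01.
- by move=> s /[!in_itv]/= /andP[s0 s1]; apply: dg; apply: ltW.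
- apply: derivable_within_continuous => s /[!in_itv]/= /andP[s0 s1].
  by have [] := dg s s0 s1.
rewrite subr0 mulr1 /g rmorph1 rmorph0 mul1r mul0r addr0 (addrC a) subrK.
rewrite -raddfB -mulrBr -/w uw => E.
rewrite -(rf_re_norm rf) E; apply: le_trans (le_re _) _.
rewrite normrM u1 mul1r normrM ler_wpM2r //; apply/fM/bs; exact: ltW.
Qed.

Lemma constant_on_ball (f : K -> K) (c e : K) :
  (forall w, ball c e w -> derivable f w 1) -> (forall w, ball c e w -> derive1 f w = 0) ->
  forall a b, ball c e a -> ball c e b -> f a = f b.
Proof.
move=> df f0 a b ca cb.
have := @mean_value f c e 0 df _ b a cb ca; rewrite mul0r normr_le0 subr_eq0 => H.
by apply/eqP/H => w cw; rewrite f0 // normr0.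
Qed.

(** The series of increments telescopes and is dominated by a geometric series. *)
Lemma fast_cauchy_real (u : R^nat) (C : R) :
  (forall n, `|u n.+1 - u n| <= C * 2^-1 ^+ n) -> cvg (u n @[n --> \oo]).
Proof.
move=> uC; pose d n := u n.+1 - u n.
have -> : u = (fun n => u 0%N + series d n).
  by apply/funext => n; rewrite /series /= telescope_sumr // addrC subrK.
apply: is_cvgD; first exact: is_cvg_cst.
apply: normed_cvg; apply: (@series_le_cvg _ _ (geometric C 2^-1)) => [n|n|n|].
- exact: normr_ge0.
- by rewrite /geometric /= (le_trans _ (uC n)).
- exact: uC.
- apply: is_cvg_geometric_series; rewrite ger0_norm ?invr_ge0 // invf_lt1 // ltr1n //.
Qed.

(** Completeness of [K] in the form that the iteration below needs: the real and imaginary parts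
    inherit the bound, as they do not exceed the modulus. *)
Lemma fast_cauchy (u : nat -> K) (C : K) :
  (forall n, `|u n.+1 - u n| <= C * 2^-1 ^+ n) -> cvg (u n @[n --> \oo]).
Proof.
move=> uC; have C0 : 0 <= C by have := uC 0%N; rewrite expr0 mulr1; exact: le_trans.
have H (p : {additive K -> R}) : (forall z : K, iota `|p z| <= `|z|) -> cvg (p (u n) @[n -->
  \oo]).
  move=> hp; apply: (@fast_cauchy_real (p \o u) (re C)) => n.
  rewrite -(rf_le rf) rmorphM rmorphXn fmorphV rmorph_nat inj_re //=.
  by rewrite -raddfB; apply: le_trans (uC n); exact: hp.
have /cvg_ex[/= a ua] := H _ (rf_norm_re rf).
have /cvg_ex[/= b ub] := H _ (rf_norm_im rf).
apply/cvg_ex; exists (iota a + rf_unit rf * iota b).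
rewrite (_ : (fun n => u n) = (fun n => iota (re (u n)) + rf_unit rf * iota (rf_im rf (u n)))).
  apply: cvgD; first by apply: continuous_cvg ua; exact: inj_continuous.
  by apply: cvgM; [exact: cvg_cst|apply: continuous_cvg ub; exact: inj_continuous].
by apply/funext => n; exact: rf_split.
Qed.


End MeanValue.

(** * Inverse functions *)

Section InverseFunction.
Variables (R : realType) (K : numFieldType) (rf : real_form R K).

(* Newton's iteration with the slope frozen at its value at t0. *)
Lemma ball_surjective (f : K -> K) (t0 d e : K) : d != 0 -> 0 < e ->
  (forall a b, ball t0 e a -> ball t0 e b ->
     `|(b - a) - (f b - f a) / d| <= 2^-1 * `|b - a|) ->
  (forall t, ball t0 e t -> {for t, continuous f}) ->
  forall y, `|y - f t0| < `|d| * (e / 4) -> exists2 t, ball t0 e t & f t = y.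
Proof.
move=> d0 e0 lip cf y yt; pose h t := t - (f t - y) / d.
have hh a b : h b - h a = (b - a) - (f b - f a) / d by rewrite /h; ring.
pose u n := iter n h t0.
have half n : 2^-1 ^+ n.+1 = 2^-1 ^+ n / 2 :> K by rewrite exprSr.
have halfgt0 n : 0 < 2^-1 ^+ n :> K by rewrite exprn_gt0 // invr_gt0.
have d1 : `|u 1%N - u 0%N| <= e / 4.
  rewrite /u /= /h addrAC subrr add0r normrN normrM normfV -normrN opprB.
  by rewrite ler_pdivrMr ?normr_gt0 // mulrC ltW.
(* The increments add up to at most e / 2, which keeps the iterates where the contraction estimate
   holds. *)
have main n : ball t0 e (u n) /\ `|u n.+1 - u n| <= e / 4 * 2^-1 ^+ n /\
    `|u n - t0| <= e / 2 * (1 - 2^-1 ^+ n).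
  elim: n => [|n [bn [dn tn]]].
    split; first exact: ballxx.
    by split; rewrite ?expr0 ?mulr1 // /u /= !subrr normr0 mulr0.
  have tn1 : `|u n.+1 - t0| <= e / 2 * (1 - 2^-1 ^+ n.+1).
    rewrite (_ : _ - t0 = (u n.+1 - u n) + (u n - t0)); last by rewrite addrA subrK.
    apply: le_trans (ler_normD _ _) _; apply: le_trans (lerD dn tn) _.
    by rewrite half le_eqVlt; apply/orP; left; apply/eqP; field.
  have bn1 : ball t0 e (u n.+1).
    rewrite -ball_normE /= distrC; apply: le_lt_trans tn1 _.
    apply: (@lt_le_trans _ _ (e / 2 * 1)); last first.
      by rewrite mulr1 ler_pdivrMr // mulr_natr mulr2n lerDl ltW.
    by rewrite ltr_pM2l ?divr_gt0 // ltrBlDr ltrDl.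
  split=> //; split=> //; rewrite [u n.+2]/(h (u n.+1)) [X in _ - X]/(h (u n)) hh.
  apply: le_trans (lip _ _ bn bn1) _; rewrite half mulrA [X in _ <= X]mulrC.
  by rewrite ler_wpM2l // invr_ge0.
have /cvg_ex[/= p up] : cvg (u n @[n --> \oo]).
  by apply: (fast_cauchy rf (C := e / 4)) => n; have [_ []] := main n.
(* The bound e / 2 for the iterates leaves the limit within 3e / 4 of [t0], inside the open ball. *)
have bp : ball t0 e p.
  have e4 : 0 < e / 4 by rewrite divr_gt0.
  have [N _ /(_ N (leqnn N)) /= uN] := cvgr_dist_lt _ _ up _ e4.
  have [_ [_ tN]] := main N.
  rewrite -ball_normE /= distrC (_ : p - t0 = (p - u N) + (u N - t0));
    last by rewrite addrA subrK.
  apply: le_lt_trans (ler_normD _ _) _; apply: (@lt_le_trans _ _ (e / 4 + e / 2)).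
    apply: ltr_leD => //; apply: le_trans tN _.
    by rewrite ler_piMr ?divr_ge0 ?ltW // ltrBlDr ltrDl.
  have E5 : e = e / 4 + e / 2 + e / 4 by field.
  by rewrite [leRHS]E5 lerDl ltW.
exists p => //.
have hp : h (u n) @[n --> \oo] --> h p.
  apply: cvgB => //; apply: cvgM; last exact: cvg_cst.
  apply: cvgB; last exact: cvg_cst.
  exact: continuous_cvg (cf _ bp) up.
(* The shifted sequence tends both to h(p) and to p; a fixed point of [h] solves f(p) = y. *)
have : h p = p.
  have up1 : h (u n) @[n --> \oo] --> p by move: up; rewrite -(cvg_shiftS u).
  by rewrite -(cvg_lim _ hp) // (cvg_lim _ up1).
move=> /eqP; rewrite /h -subr_eq0 addrAC subrr add0r oppr_eq0 mulf_eq0 invr_eq0.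
by rewrite (negbTE d0) orbF subr_eq0 => /eqP.
Qed.

Lemma local_inverse (I : set K) (f : K -> K) (t0 : K) :
  open I -> I t0 -> smooth1_on I f -> (forall t, I t -> derive1 f t != 0) ->
  exists (I' J : set K) (s : K -> K),
    [/\ open I', I' t0, open J, smooth1_on J s &
      [/\ forall t, I' t -> I t, forall t, I' t -> J (f t) /\ s (f t) = t &
         forall y, J y -> I' (s y) /\ f (s y) = y]].
Proof.
move=> oI It0 sf f0; set d := derive1 f t0; have d0 : d != 0 by exact: f0.
have df t : I t -> derivable f t 1 by exact: (sf 0%N).
have cf t : I t -> {for t, continuous f}.
  by move=> It; apply/differentiable_continuous/derivable1_diffP/df.
have cdf : {for t0, continuous (derive1 f)}.
  by apply/differentiable_continuous/derivable1_diffP; exact: (sf 1%N).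
(* Close to [t0] the derivative of [g] is at most 1/2 in modulus, so the mean value inequality gives
   the contraction estimate that [ball_surjective] requires. *)
pose g t := t - f t / d.
have dg t : I t -> is_derive t 1 g (1 - derive1 f t / d).
  move=> It; have ? : is_derive t 1 f (derive1 f t) by rewrite derive1E; apply/derivableP/df.
  rewrite /g; apply: is_derive_eq; rewrite scaler0 add0r /GRing.scale /= mulrC //.
have /nbhs_ballP[e /= e0 eI] : \forall t \near t0, I t /\ `|1 - derive1 f t / d| <= 2^-1.
  have h0 : (0 : K) < 2^-1 by rewrite invr_gt0.
  near=> t; split; first by near: t; exact: open_nbhs_nbhs.
  rewrite (_ : 1 - _ = (d - derive1 f t) / d); last by rewrite mulrBl divff.
  rewrite normrM normfV ler_pdivrMr ?normr_gt0 // ltW //; near: t.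
  by apply: (cvgr_dist_lt _ _ cdf); rewrite mulr_gt0 // normr_gt0.
have lip a b : ball t0 e a -> ball t0 e b ->
     `|(b - a) - (f b - f a) / d| <= 2^-1 * `|b - a|.
  move=> ba bb; rewrite (_ : _ - _ = g b - g a); last by rewrite /g; ring.
  apply: (mean_value rf (c := t0) (e := e)) => // w /eI[Iw hw].
    by have [] := dg _ Iw.
  by rewrite derive1E; have [_ ->] := dg _ Iw.
(* The reverse estimate: it yields injectivity of [f] on the ball and continuity of the inverse. *)
have below a b : ball t0 e a -> ball t0 e b -> `|b - a| <= 2 * (`|f b - f a| / `|d|).
  move=> ba bb; set q := (f b - f a) / d; rewrite -normfV -normrM -/q.
  have : `|b - a| <= 2^-1 * `|b - a| + `|q|.
    apply: (@le_trans _ _ (`|b - a - q| + `|q|)); last by rewrite lerD2r; exact: lip.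
    by rewrite -[X in `|X| <= _](subrK q) ler_normD.
  rewrite -lerBlDl (_ : `|b - a| - _ = 2^-1 * `|b - a|); last by field.
  by rewrite ler_pdivrMl.
pose J := ball (f t0) (`|d| * (e / 4)).
have surj y : J y -> exists2 t, ball t0 e t & f t = y.
  move=> Jy; apply: (ball_surjective d0 e0 lip) => [t /eI[It _]|]; first exact: cf.
  by move: Jy; rewrite /J -ball_normE /= distrC.
(* A preimage in the ball, with [t0] as the default value if there is none. *)
pose s y := xget t0 [set t | ball t0 e t /\ f t = y].
have sP y : J y -> ball t0 e (s y) /\ f (s y) = y.
  move=> /surj[t bt ft]; rewrite /s; case: xgetP => [? _ //|/(_ t)]; by case.
pose I' := ball t0 e `&` f @^-1` J.
have oI' : open I'.
  rewrite openE => t [bt Jt]; apply: filterI.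
    by apply: open_nbhs_nbhs; split => //; exact: ball_open.
  apply: cf; first by case: (eI _ bt).
  by apply: open_nbhs_nbhs; split => //; exact: ball_open.
have JsI y : J y -> I (s y) by move=> /sP[/eI[]].
have Jpos : 0 < `|d| * (e / 4) by rewrite mulr_gt0 ?normr_gt0 // divr_gt0.
have inj_f a b : ball t0 e a -> ball t0 e b -> f a = f b -> a = b.
  move=> ba bb fab; have := below _ _ ba bb.
  by rewrite fab subrr normr0 mul0r mulr0 normr_le0 subr_eq0 => /eqP.
have oJ : open J by exact: ball_open.
exists I', J, s; split=> //.
- by split; [exact: ballxx|rewrite /= /J; exact: ballxx].
- apply: (smooth1_inverse oJ sf f0 JsI) => y Jy; set p := s y; have [bp fp] := sP _ Jy.
  have nJ : \forall z \near y, J z by exact: open_nbhs_nbhs.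
  have nJ0 : \forall h \near (0 : K), J (h + y).
    by move: nJ; rewrite (near_shift 0 y) /=; apply: filterS => h; rewrite subr0.
  have sc : s z @[z --> y] --> p.
    apply/(@cvgrPdist_lt _ _ _ (nbhs y)) => r r0; near=> z; have Jz : J z by near: z.
    have [bz fz] := sP _ Jz; rewrite distrC; apply: le_lt_trans (below _ _ bp bz) _.
    rewrite fz fp mulrA ltr_pdivrMr ?normr_gt0 // -ltr_pdivlMl // distrC; near: z.
    by apply: cvgr_dist_lt => //; rewrite mulr_gt0 ?invr_gt0 // mulr_gt0 // normr_gt0.
  have sc0 : s (h + y) @[h --> 0] --> p.
    move=> A /sc H; have : \forall z \near y, A (s z) := H.
    by rewrite (near_shift 0 y) /=; apply: filterS => h; rewrite subr0.
  (* The increment of [s] tends to 0 without vanishing, as [s] is injective on [J], so it can serve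
     as the increment in the difference quotient of [f]. *)
  have kc : s (h + y) - p @[h --> 0^'] --> 0^'.
    move=> A A0; change (\forall h \near (0 : K), h != 0 -> A (s (h + y) - p)).
    have kc0 : s (h + y) - p @[h --> 0] --> (0 : K).
      by have := cvgB sc0 (cvg_cst p); rewrite subrr; apply.
    have A1 : \forall h \near (0 : K), s (h + y) - p != 0 -> A (s (h + y) - p) := kc0 _ A0.
    near=> h => h0; have Jh : J (h + y) by near: h.
    have : s (h + y) - p != 0 -> A (s (h + y) - p) by near: h.
    apply; rewrite subr_eq0; apply: contra_neq h0 => shp.
    by have [_] := sP _ Jh; rewrite shp fp -{1}[y]add0r => /addIr.
  have Df : k^-1 *: (f (k + p) - f p) @[k --> 0^'] --> derive1 f p.
    have := df _ (JsI _ Jy); rewrite /derivable -/p derive1E /derive.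
    by rewrite (_ : (fun h => _) = (fun k => k^-1 *: (f (k + p) - f p))) //;
      apply/funext => h /=; rewrite [h *: 1]mulr1.
  (* The difference quotient of [s] is the reciprocal of the difference quotient of [f] at the
     increment s(h + y) - p. *)
  have Ds : h^-1 *: (s (h + y) - p) @[h --> 0^'] --> (derive1 f p)^-1.
    have C := cvgV (f0 _ (JsI _ Jy)) (cvg_comp _ _ kc Df).
    apply: (@cvg_trans _ ((fun h => ((s (h + y) - p)^-1 *: (f (s (h + y) - p + p) - f p))^-1) @
      (0 : K)^')).
      2: exact: C.
    apply: near_eq_cvg; near=> h.
    have Jh : J (h + y).
      near: h; change (\forall h \near (0 : K), h != 0 -> J (h + y)).
      by apply: filterS nJ0.
    have [_ fh] := sP _ Jh.
    by rewrite /= subrK fh fp addrK /GRing.scale /= invfM invrK mulrC.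
  have Ds' : h^-1 *: ((s \o shift y) (h *: 1) - s y) @[h --> 0^'] --> (derive1 f p)^-1.
    by move: Ds; rewrite (_ : (fun h => h^-1 *: (s (h + y) - p)) = (fun h => h^-1 *: ((s \o shift
      y) (h *: 1) - s y))) //; apply/funext => h /=; rewrite [h *: 1]mulr1.
  by apply: DeriveDef; [apply/cvg_ex; eexists; exact: Ds'|exact: cvg_lim Ds'].
- split=> [t [/eI[]]|t [bt Jt]|y Jy] //; last by have [? fs] := sP _ Jy; rewrite /I' /= fs.
  by split=> //; have [bs fs] := sP _ Jt; exact: inj_f.
Unshelve. all: by end_near. Qed.

End InverseFunction.

(** * Jets and total derivatives *)

Section SmoothOn.
Variables (K : numFieldType) (n : nat) (U : set 'rV[K]_n).
Hypothesis oU : open U.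
Implicit Types f g : 'rV[K]_n -> K.

Lemma smooth_diff f p : smooth_on U f -> U p -> differentiable f p.
Proof. by move=> sf; exact: (sf [::]). Qed.

Lemma smooth_cst (c : K) : smooth_on U (cst c).
Proof. by apply/smooth_onP => m; exact: Ck_cst. Qed.

Lemma smooth_coord (k : 'I_n) : smooth_on U (fun p => p 0 k).
Proof. by apply/smooth_onP => m; exact: Ck_coord. Qed.

Lemma smooth_add f g : smooth_on U f -> smooth_on U g -> smooth_on U (f \+ g).
Proof. by move=> /smooth_onP sf /smooth_onP sg; apply/smooth_onP => m; exact: Ck_add. Qed.

Lemma smooth_sub f g : smooth_on U f -> smooth_on U g -> smooth_on U (f \- g).
Proof. by move=> /smooth_onP sf /smooth_onP sg; apply/smooth_onP => m; exact: Ck_sub. Qed.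

Lemma smooth_mul f g : smooth_on U f -> smooth_on U g -> smooth_on U (f \* g).
Proof. by move=> /smooth_onP sf /smooth_onP sg; apply/smooth_onP => m; exact: Ck_mul. Qed.

Lemma smooth_inv f : (forall p, U p -> f p != 0) -> smooth_on U f -> smooth_on U (fun p => (f
  p)^-1).
Proof. by move=> f0 /smooth_onP sf; apply/smooth_onP => m; exact: Ck_inv. Qed.

Lemma smooth_exp f m : smooth_on U f -> smooth_on U (fun p => f p ^+ m).
Proof.
move=> sf; elim: m => [|m IH]; first exact: (smooth_cst 1).
apply: (@smooth_on_eq _ _ _ _ oU (f \* (fun p => f p ^+ m))); last exact: smooth_mul.
by move=> p _; rewrite /= exprS.
Qed.

Lemma smooth_sum (I : Type) (s : seq I) (P : pred I) (F : I -> 'rV[K]_n -> K) :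
  (forall i, P i -> smooth_on U (F i)) -> smooth_on U (fun p => \sum_(i <- s | P i) F i p).
Proof. by move=> sF; apply/smooth_onP => m; apply: Ck_sum => // i Pi;
  have /smooth_onP := sF i Pi; exact. Qed.

Lemma smooth_det q (M : 'rV[K]_n -> 'M[K]_q) :
  (forall i j, smooth_on U (fun p => M p i j)) -> smooth_on U (fun p => \det (M p)).
Proof. by move=> sM; apply/smooth_onP => m; apply: Ck_det => // i j; have /smooth_onP := sM i j;
  exact. Qed.

Lemma smooth_partial f i : smooth_on U f -> smooth_on U (partial i f).
Proof. by move=> /smooth_onP sf; apply/smooth_onP => m; case: (sf m.+1) => _; exact. Qed.

Lemma smooth_rVP q (f : 'rV[K]_n -> 'rV[K]_q) :
  smooth_on U f <-> forall k, smooth_on U (fun p => f p 0 k).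
Proof.
split=> [/smooth_onP sf k|sf]; apply/smooth_onP => m; first by move/(Ck_rVP oU): (sf m); exact.
by apply/(Ck_rVP oU) => k; have /smooth_onP := sf k; exact.
Qed.

Lemma smooth_comp q (W : set 'rV[K]_q) (F : 'rV[K]_q -> K) (g : 'rV[K]_n -> 'rV[K]_q) :
  (forall p, U p -> W (g p)) -> smooth_on W F -> (forall k, smooth_on U (fun p => g p 0 k)) ->
  smooth_on U (F \o g).
Proof.
move=> UW /smooth_onP sF sg; apply/smooth_onP => m; apply: (Ck_comp oU UW) => // k.
by have /smooth_onP := sg k; exact.
Qed.

End SmoothOn.

Section Depends.
Variables (K : numFieldType) (n : nat).
Implicit Types f g : 'rV[K]_n -> K.

(* The coordinate x^(k) of a jet has index k + 1. *)
Definition depends m f := forall j j' : 'rV[K]_n,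
  (forall i : 'I_n, (i <= m)%N -> j 0 i = j' 0 i) -> f j = f j'.

Lemma depends_le m m' f : (m <= m')%N -> depends m f -> depends m' f.
Proof. by move=> mm df j j' jj; apply: df => i im; apply: jj; exact: leq_trans mm. Qed.

Lemma depends_cst m (c : K) : depends m (cst c).
Proof. by []. Qed.

Lemma depends_coord m (i : 'I_n) : (i <= m)%N -> depends m (fun j => j 0 i).
Proof. by move=> im j j'; exact. Qed.

Lemma depends_add m f g : depends m f -> depends m g -> depends m (f \+ g).
Proof. by move=> df dg j j' jj /=; rewrite (df _ _ jj) (dg _ _ jj). Qed.

Lemma depends_mul m f g : depends m f -> depends m g -> depends m (f \* g).
Proof. by move=> df dg j j' jj /=; rewrite (df _ _ jj) (dg _ _ jj). Qed.

Lemma depends_sum m (I : Type) (s : seq I) (P : pred I) (F : I -> 'rV[K]_n -> K) :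
  (forall i, P i -> depends m (F i)) -> depends m (fun p => \sum_(i <- s | P i) F i p).
Proof. by move=> dF j j' jj; apply: eq_bigr => i Pi; exact: dF. Qed.

Lemma depends_partial m f i : depends m f -> depends m (partial i f).
Proof.
move=> df j j' jj; rewrite /partial /derive.
set a := (fun h : K => _); set b := (fun h : K => _); suff -> : a = b by [].
apply/funext => h; rewrite /a /b /= (df j j') //; congr (_ *: (_ - _)).
by apply: df => k km; rewrite !mxE jj.
Qed.

Lemma partial_indep m f (i : 'I_n) : depends m f -> (m < i)%N -> partial i f = cst 0.
Proof.
move=> df mi; apply/funext => j; rewrite /partial /derive.
rewrite (_ : (fun h => _) = cst 0) ?lim_cst //; apply/funext => h /=.
rewrite (df _ j) ?subrr ?scaler0 // => k km; rewrite !mxE /=.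
by rewrite (_ : (k == i) = false) ?mulr0 ?add0r //; apply/negbTE; apply: contraTneq km => ->;
  rewrite -ltnNge.
Qed.

End Depends.

Section Jets.
Variables (K : numFieldType) (r : nat).
Local Notation jet := 'rV[K]_(r.+2).
Local Notation point := 'rV[K]_2.
Local Notation D := (@total_derivative K r).
Implicit Types (f g : jet -> K) (u : point -> K) (j : jet).

(** The vector field of D; its component along x^(r) is 0 by the truncation. It reduces the rules
    for D to those for directional derivatives. *)
Definition jet_field j : jet :=
  \row_(i < r.+2) if val i is k.+1 then (if (k < r)%N then j 0 (inord k.+2) else 0) else 1.

Lemma total_derivativeE f j : differentiable f j -> D f j = 'D_(jet_field j) f j.
Proof.
move=> df; rewrite derive_partial // big_ord_recl mxE /= mul1r; congr (_ + _).
rewrite big_ord_recr /= mxE /= add0n ltnn mul0r addr0.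
apply: eq_bigr => k _; rewrite mxE /= add0n ltn_ord; congr (_ * partial _ f j).
by apply/val_inj; rewrite /= inordK // !ltnS ltnW.
Qed.

Lemma D_eq (W : set jet) f g : open W -> (forall j, W j -> f j = g j) -> forall j, W j -> D f j =
  D g j.
Proof.
move=> oW fg j Wj; rewrite /total_derivative (partial_eq_on oW _ fg Wj); congr (_ + _).
by apply: eq_bigr => k _; rewrite (partial_eq_on oW _ fg Wj).
Qed.

Lemma D_cst (c : K) j : D (cst c) j = 0.
Proof. by rewrite total_derivativeE // derive_cst. Qed.

Lemma D_add f g j : differentiable f j -> differentiable g j -> D (f \+ g) j = D f j + D g j.
Proof.
move=> df dg; rewrite !total_derivativeE //; last exact: differentiableD.
by rewrite deriveD //; exact: diff_derivable.
Qed.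

Lemma D_mul f g j : differentiable f j -> differentiable g j ->
  D (f \* g) j = D f j * g j + f j * D g j.
Proof.
move=> df dg; rewrite !total_derivativeE //; last exact: differentiableM.
rewrite deriveM; [|exact: diff_derivable..].
by rewrite addrC mulrC.
Qed.

Lemma D_inv f j : differentiable f j -> f j != 0 -> D (fun j => (f j)^-1) j = - D f j / f j ^+ 2.
Proof.
move=> df f0; rewrite !total_derivativeE //; last exact: differentiableV.
by rewrite deriveV //; [rewrite /GRing.scale /= mulrC mulrN mulNr|exact: diff_derivable].
Qed.

Lemma D_x k j : (k < r)%N -> D (jet_x k) j = jet_x k.+1 j.
Proof.
move=> kr; rewrite total_derivativeE; last exact: differentiable_coord.
rewrite derive_partial; last exact: differentiable_coord.
have ik : val (inord k.+1 : 'I_r.+2) = k.+1 by rewrite /= inordK // !ltnS ltnW.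
rewrite (bigD1 (inord k.+1)) //= big1 => [|i ik']; rewrite partial_coord ?(negbTE ik') ?mulr0 //.
by rewrite eqxx mulr1 addr0 mxE ik kr.
Qed.

Lemma smooth_D (W : set jet) f : open W -> smooth_on W f -> smooth_on W (D f).
Proof.
move=> oW sf; apply: smooth_add => //; first exact: smooth_partial.
apply: smooth_sum => // k _; apply: smooth_mul => //; first exact: smooth_coord.
exact: smooth_partial.
Qed.

(** A term with the factor x^(k+1) survives only if [f] involves x^(k), so the order rises by at
    most one. *)
Lemma depends_D m f : (0 < m)%N -> depends m f -> depends m.+1 (D f).
Proof.
move=> m0 df; apply: depends_add.
  by apply: depends_le (leqnSn m) _; exact: depends_partial.
apply: depends_sum => k _; have kE : (inord k.+1 : 'I_r.+2) = k.+1 :> nat by rewrite inordK //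
  !ltnS ltnW.
have [km|mk] := leqP k.+1 m.
  apply: depends_mul; last by apply: depends_le (leqnSn m) _; exact: depends_partial.
  apply: depends_coord; rewrite inordK; first exact: leq_trans km _.
  by rewrite !ltnS.
move=> j j' _; by rewrite (partial_indep df) ?mulr0 // kE.
Qed.

Lemma tvar_base j : tvar (base j) = jet_t j.
Proof. by rewrite /tvar mxE; congr (j 0 _); apply/val_inj; rewrite /= inordK. Qed.

Lemma xvar_base j : xvar (base j) = jet_x 0 j.
Proof. by rewrite /xvar mxE. Qed.

Lemma smooth_base (W : set jet) k : open W -> smooth_on W (fun j : jet => base j 0 k).
Proof.
move=> oW; apply: (smooth_on_eq oW (f := fun j : jet => j 0 (inord k))); last exact: smooth_coord.
by move=> j _; rewrite mxE.
Qed.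

Lemma base_continuous : continuous (@base K r).
Proof.
move=> j; apply: differentiable_continuous; apply: differentiable_rV => k.
exact: (smooth_diff (smooth_base k openT)).
Qed.

Lemma open_base (U : set point) : open U -> open (@base K r @^-1` U).
Proof. by move=> oU; apply: open_comp => // j _; exact: base_continuous. Qed.

Lemma smooth_lift (U : set point) u : open U -> smooth_on U u ->
  smooth_on (@base K r @^-1` U) (u \o @base K r).
Proof.
move=> oU su; have oW := open_base oU.
by apply: (smooth_comp oW _ su) => // k; exact: smooth_base.
Qed.

Lemma depends_lift u : depends 1 (u \o @base K r).
Proof.
move=> j j' jj /=; congr u; apply/rowP => i; rewrite !mxE; apply: jj.
by case: i => -[|[|]] //= *; rewrite inordK.
Qed.

(** [base] is linear, and its derivative along [jet_field] is (1, x'). *)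
Lemma D_lift u j : (0 < r)%N -> differentiable u (base j) ->
  D (u \o @base K r) j = partial 0 u (base j) + jet_x 1 j * partial 1 u (base j).
Proof.
move=> r0 du; have db : differentiable (@base K r) j.
  by apply: differentiable_rV => k; exact: (smooth_diff (smooth_base k openT)).
rewrite total_derivativeE; last exact: differentiable_comp.
have dlin : 'D_(jet_field j) (@base K r) j = base (jet_field j).
  apply/rowP => k; rewrite derive_rV // mxE.
  rewrite (_ : (fun q => _) = (fun q : jet => q 0 (inord k))); last by apply/funext => q;
    rewrite mxE.
  rewrite derive_partial; last exact: differentiable_coord.
  rewrite (bigD1 (inord k)) //= big1 => [|i ik']; rewrite partial_coord ?(negbTE ik') ?mulr0 //.
  by rewrite eqxx mulr1 addr0.
rewrite deriveE; last exact: differentiable_comp.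
rewrite diff_comp //= -[X in 'd u _ X]deriveE // dlin -deriveE // derive_partial //.
rewrite big_ord_recl big_ord1 !mxE /= inordK // mul1r; congr (_ + _).
rewrite inordK //= r0; congr (_ * _); by congr (partial _ u _); apply/val_inj.
Qed.

End Jets.

(** * Prolongation of a point transformation to jets *)

Section Prolong.
Variables (K : numFieldType) (r : nat).
Local Notation jet := 'rV[K]_(r.+2).
Local Notation point := 'rV[K]_2.
Local Notation D := (@total_derivative K r).
Implicit Types (j : jet) (p : point).

Definition mkpoint (t x : K) : point := \row_(i < 2) if i == 0 then t else x.
Definition mkjet (t : K) (y : nat -> K) : jet := \row_(i < r.+2) if val i is k.+1 then y k else t.

Lemma jet_t_mkjet t y : jet_t (mkjet t y) = t.
Proof. by rewrite /jet_t mxE. Qed.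

Lemma jet_x_mkjet t y k : (k <= r)%N -> jet_x k (mkjet t y) = y k.
Proof. by move=> kr; rewrite /jet_x mxE /= inordK. Qed.

Lemma pointP p q : tvar p = tvar q -> xvar p = xvar q -> p = q.
Proof.
move=> pq0 pq1; apply/rowP => -[[|[|i]] hi] //.
  by rewrite (_ : Ordinal hi = 0) //; exact/val_inj.
by rewrite (_ : Ordinal hi = 1) //; exact/val_inj.
Qed.

Lemma base_mkjet t y p : tvar p = t -> xvar p = y 0%N -> base (mkjet t y) = p.
Proof.
move=> pt px; apply: pointP; first by rewrite tvar_base jet_t_mkjet.
by rewrite xvar_base jet_x_mkjet.
Qed.

Variable T : transformation K 2.
Definition t_comp p := tvar (T p).
Definition x_comp p := xvar (T p).

Lemma open_tr_dom : open (tr_dom T).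
Proof. exact: tr_dom_open. Qed.

Lemma smooth_T : smooth_on (tr_dom T) T.
Proof. by move=> s p; exact: tr_smooth. Qed.

Lemma smooth_t_comp : smooth_on (tr_dom T) t_comp.
Proof. exact: ((smooth_rVP open_tr_dom T).1 smooth_T 0). Qed.

Lemma smooth_x_comp : smooth_on (tr_dom T) x_comp.
Proof. exact: ((smooth_rVP open_tr_dom T).1 smooth_T 1). Qed.

Lemma jacobianE n m (f : 'rV[K]_n -> 'rV[K]_m) q i k : differentiable f q ->
  jacobian f q i k = partial i (fun q => f q 0 k) q.
Proof. by move=> df; rewrite /partial -derive_rV // deriveE // mxE. Qed.

Lemma jacobian_point p : tr_dom T p ->
  \det (jacobian T p) = partial 0 t_comp p * partial 1 x_comp p - partial 0 x_comp p * partial 1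
    t_comp p.
Proof.
move=> Tp; have dT : differentiable T p := @smooth_T [::] p Tp.
rewrite (expand_det_row _ 0) big_ord_recl big_ord1 /cofactor !det_mx11 !mxE -!deriveE //
  !derive_rV //.
rewrite /= expr0 expr1 mul1r mulN1r mulrN.
have P (i k i' k' : 'I_2) : i = i' -> k = k' ->
    'D_(delta_mx 0 i) (fun q => T q 0 k) p = 'D_(delta_mx 0 i') (fun q => T q 0 k') p.
  by move=> -> ->.
by congr (_ * _ - _ * _); apply: P; exact/val_inj.
Qed.

Hypothesis r0 : (0 < r)%N.
Local Notation lifted U := (@base K r @^-1` U).
Local Notation DT := (D (new_t T)).

Lemma D_new_t j : tr_dom T (base j) ->
  DT j = partial 0 t_comp (base j) + jet_x 1 j * partial 1 t_comp (base j).
Proof. by move=> Tj; rewrite (@D_lift _ _ t_comp) //; exact: smooth_diff smooth_t_comp _. Qed.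

Lemma D_new_x0 j : tr_dom T (base j) ->
  D (new_x T 0) j = partial 0 x_comp (base j) + jet_x 1 j * partial 1 x_comp (base j).
Proof. by move=> Tj; rewrite (@D_lift _ _ x_comp) //; exact: smooth_diff smooth_x_comp _. Qed.

Lemma smooth_new_t : smooth_on (lifted (tr_dom T)) (new_t T).
Proof. exact: (@smooth_lift _ r _ _ open_tr_dom smooth_t_comp). Qed.

Lemma smooth_DT : smooth_on (lifted (tr_dom T)) DT.
Proof. by apply: smooth_D smooth_new_t; apply: open_base; exact: open_tr_dom. Qed.

Lemma smooth_new_x0 : smooth_on (lifted (tr_dom T)) (new_x T 0).
Proof. exact: (@smooth_lift _ r _ _ open_tr_dom smooth_x_comp). Qed.

Lemma smooth_subset (n : nat) (U W : set 'rV[K]_n) (f : 'rV[K]_n -> K) :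
  U `<=` W -> smooth_on W f -> smooth_on U f.
Proof. by move=> UW sf s p Up; apply: sf; exact: UW. Qed.

Lemma open_prolong_dom : open (@prolong_dom K r T).
Proof.
have oW := open_base open_tr_dom (r := r).
rewrite openE => j [Tj DTj]; near=> j'; split; near: j'.
  by apply: open_nbhs_nbhs; split.
have cD : {for j, continuous DT} by apply/differentiable_continuous;
  exact: smooth_diff smooth_DT _.
apply: (cvgr_neq0 _ cD DTj).
Unshelve. all: by end_near. Qed.

Lemma smooth_new_x k : smooth_on (@prolong_dom K r T) (new_x T k).
Proof.
have open_prolong := open_prolong_dom.
elim: k => [|k IH]; first by apply: smooth_subset smooth_new_x0 => j [].
apply: smooth_mul => //; first exact: smooth_D.
by apply: smooth_inv => // [j []//|]; apply: smooth_subset smooth_DT => j [].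
Qed.

Lemma depends_new_t : depends 1 (@new_t K r T).
Proof. exact: (@depends_lift _ _ t_comp). Qed.

Lemma depends_DT : depends 2 DT.
Proof. by apply: depends_D => //; exact: depends_new_t. Qed.

Lemma depends_inv m (f : jet -> K) : depends m f -> depends m (fun j => (f j)^-1).
Proof. by move=> df j j' jj; rewrite (df _ _ jj). Qed.

Lemma depends_new_x k : depends k.+1 (@new_x K r T k).
Proof.
elim: k => [|k IH]; first exact: (@depends_lift _ _ x_comp).
apply: depends_mul; first exact: depends_D.
by apply: depends_inv; apply: depends_le depends_DT.
Qed.

End Prolong.

(** * Preservation of the fibres *)

Section Core.
Variables (K : numFieldType) (r : nat).
Local Notation jet := 'rV[K]_(r.+2).
Local Notation point := 'rV[K]_2.
Local Notation D := (@total_derivative K r).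
Local Notation lifted U := (@base K r @^-1` U).
Implicit Types (j : jet) (p : point).
Variables (T : transformation K 2) (E E' : linear_ode K r) (U : set point).
Hypotheses (r3 : (3 <= r)%N) (oU : open U) (UT : U `<=` tr_dom T) (TE : maps_ode T U E E').
Local Notation DT := (D (new_t T)).

Let r0 : (0 < r)%N. Proof. exact: leq_trans r3. Qed.

Lemma differentiable_exp (f : jet -> K) m j : differentiable f j ->
  differentiable (fun j => f j ^+ m) j.
Proof.
move=> df; elim: m => [|m IH]; first exact: (differentiable_cst (1 : K)).
rewrite (_ : (fun j => _) = f \* (fun j => f j ^+ m)); last by apply/funext => i; rewrite exprS.
exact: differentiableM.
Qed.

Lemma D_exp (f : jet -> K) m j : differentiable f j ->
  D (fun j => f j ^+ m.+1) j = m.+1%:R * f j ^+ m * D f j.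
Proof.
move=> df; elim: m => [|m IH].
  by rewrite expr0 mulr1 mul1r (_ : (fun j => _) = f).
rewrite (_ : (fun j => _) = f \* (fun j => f j ^+ m.+1)); last by apply/funext => i;
  rewrite exprS.
rewrite D_mul // ?IH; last exact: differentiable_exp.
by rewrite -[in RHS]natr1 !exprS; ring.
Qed.

(* The numerators of the transformed derivatives remain smooth where DT = 0. *)
Fixpoint numer n : jet -> K :=
  if n is n'.+1 then fun j => DT j * D (numer n') j - (2 * n').+1%:R * numer n' j * D DT j
  else D (new_x T 0).

Lemma smooth_numer n : smooth_on (lifted (tr_dom T)) (numer n).
Proof.
have oW := open_base (@open_tr_dom _ T) (r := r); have sDT := @smooth_DT _ r T.
elim: n => [|n IH]; first by apply: smooth_D => //; exact: smooth_new_x0.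
apply: smooth_sub => //; first by apply: smooth_mul => //; exact: smooth_D.
apply: smooth_mul => //; last exact: smooth_D.
by apply: smooth_mul => //; exact: smooth_cst.
Qed.

(** The quotient rule for N / (D T)^(2n + 1), followed by division by D T, produces the exponent 2n
    + 3 and the factor 2n + 1 in the recursion for [numer]. *)
Lemma new_xE n j : prolong_dom T j -> new_x T n.+1 j = numer n j / DT j ^+ (2 * n).+1.
Proof.
elim: n j => [|n IH] j Pj; first by rewrite /= expr1.
have open_prolong := @open_prolong_dom _ r T; have [Tj dj] := Pj.
have sP (f : jet -> K) : smooth_on (lifted (tr_dom T)) f -> differentiable f j by move=> sf;
  exact: (smooth_diff sf Tj).
have dDT := sP _ (@smooth_DT _ r T); have dn := sP _ (smooth_numer n).
rewrite [LHS]/= -/(new_x T n.+1); rewrite -/(new_t T).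
rewrite (D_eq open_prolong IH Pj).
rewrite (D_mul (f := numer n) (g := fun j => (DT j ^+ (2 * n).+1)^-1)) //; last first.
  by apply: differentiableV; [exact: differentiable_exp|exact: expf_neq0].
rewrite (D_inv (f := fun j => DT j ^+ (2 * n).+1)); last exact: expf_neq0; last first.
  exact: differentiable_exp.
rewrite D_exp // [RHS]/= mulnS !addSn add0n !exprS.
have q0 : DT j ^+ (2 * n) != 0 by exact: expf_neq0.
move: (_ ^+ (2 * n)) q0 => q q0; field.
by rewrite dj q0.
Qed.

(** On D T = 0 only the second term of the recursion survives. The integer factors are nonzero in
    characteristic 0, so the pole really has order 2n + 1 where D X and D D T do not vanish. *)
Lemma numer_DT0 n j : DT j = 0 -> numer n j = (\prod_(i < n) - (2 * i).+1%:R) * D (new_x T 0) j *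
  D DT j ^+ n.
Proof.
move=> dj; elim: n => [|n IH]; first by rewrite big_ord0 mul1r expr0 mulr1.
by rewrite /= dj mul0r IH sub0r big_ord_recr exprSr /=; ring.
Qed.

(** The family x' = y, x^(k) = w over [p], with 0 for the other derivatives. It is used with k = 2
    for the blow-up and with k = r - 1 for the mixed difference. *)
Definition coords k p (y w : K) (i : nat) : K :=
  if i == 0%N then xvar p else if i == 1%N then y else if i == k then w else 0.

Definition solution_jet k p y w : jet := mkjet r (tvar p) (fun i =>
  if i == r then ode_b E (tvar p) - \sum_(i < r) ode_a E i (tvar p) * coords k p y w i
  else coords k p y w i).

Lemma solution_jet_sat k p y w : satisfies E (solution_jet k p y w).
Proof.
rewrite /satisfies jet_t_mkjet jet_x_mkjet // eqxx.
rewrite [X in _ + X](eq_bigr (fun i : 'I_r => ode_a E i (tvar p) * coords k p y w i)) ?subrK //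
  => i _.
by rewrite jet_x_mkjet 1?ltnW // ltn_eqF.
Qed.

Lemma solution_jet_x k p y w i : (i < r)%N -> jet_x i (solution_jet k p y w) = coords k p y w i.
Proof. by move=> ir; rewrite jet_x_mkjet 1?ltnW // ltn_eqF. Qed.

Lemma solution_jet_base k p y w : base (solution_jet k p y w) = p.
Proof. by apply: base_mkjet => //; rewrite ltn_eqF. Qed.

(** The new time depends on [p] alone, so the coefficients of [E'] are constants along the family of
    jets. *)
Lemma target_equation k p y w : let j := solution_jet k p y w in U p -> DT j != 0 ->
  new_x T r j + \sum_(i < r) ode_a E' i (t_comp T p) * new_x T i j = ode_b E' (t_comp T p).
Proof.
move=> j Up dj; have bj : base j = p by exact: solution_jet_base.
have Pj : prolong_dom T j by split => //; rewrite bj; exact: UT.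
have [_ /(_ j)] := TE; rewrite bj => /(_ Up Pj) [+ _] => /(_ (solution_jet_sat _ _ _ _)).
rewrite /satisfies.
have -> : jet_t (prolong T j) = t_comp T p by rewrite /jet_t mxE /= /new_t bj.
have px i : (i <= r)%N -> jet_x i (prolong T j) = new_x T i j.
  by move=> ir; rewrite /jet_x mxE /= inordK.
rewrite px //; under eq_bigr => i _ do rewrite px ?(ltnW (ltn_ord i)) //.
by [].
Qed.

(** The jet is affine in x', its entry x^(r) having slope -a_1; this makes smooth functions of it
    continuous in the parameter [s]. *)
Lemma solution_jet_line k p y w s :
  solution_jet k p (y + s) w = solution_jet k p y w + s *: mkjet r 0 (fun i =>
  if i == r then - \sum_(i < r | i == 1%N :> nat) ode_a E i (tvar p) else (i == 1%N)%:R).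
Proof.
apply/rowP => -[[|i] hi]; rewrite !mxE /=; first by rewrite mulr0 addr0.
have cE n : coords k p (y + s) w n = coords k p y w n + s * (n == 1%N)%:R.
  rewrite /coords; case: n => [|[|n]] /=; rewrite ?mulr0 ?addr0 ?mulr1 //.
case: ifP => _; last exact: cE.
rewrite mulrN -addrA; congr (_ + _); rewrite -opprD; congr (- _).
rewrite (big_mkcond (fun i : 'I_r => _ == _)) mulr_sumr -big_split; apply: eq_bigr => n _ /=.
by rewrite cE mulrDr; congr (_ + _); case: ifP; rewrite ?(mulr1, mulr0) // mulrC.
Qed.

(** The point is that x'' occurs linearly, with the factor T_x. *)
Lemma D_D_new_t j : tr_dom T (base j) ->
  D DT j = partial 0 (partial 0 (t_comp T)) (base j) + jet_x 1 j * partial 1 (partial 0 (t_comp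
    T)) (base j)
    + (jet_x 2 j * partial 1 (t_comp T) (base j) +
       jet_x 1 j * (partial 0 (partial 1 (t_comp T)) (base j) + jet_x 1 j * partial 1 (partial 1
         (t_comp T)) (base j))).
Proof.
move=> Tj; have oW := open_base (@open_tr_dom _ T) (r := r).
have st i : smooth_on (tr_dom T) (partial i (t_comp T)) by apply: smooth_partial;
  exact: smooth_t_comp.
have d i : differentiable (partial i (t_comp T) \o @base K r) j.
  exact: (smooth_diff (smooth_lift (@open_tr_dom _ T) (st i)) Tj).
have d1 : differentiable (@jet_x K r 1) j by exact: differentiable_coord.
rewrite (@D_eq _ _ _ _ ((partial 0 (t_comp T) \o @base K r) \+ (@jet_x K r 1 \* (partial 1
  (t_comp T) \o @base K r))) oW) //.
  rewrite D_add //; last exact: differentiableM.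
  rewrite D_mul // D_x; last exact: leq_trans r3.
  by rewrite !D_lift //; exact: (smooth_diff (st _) Tj).
by move=> i Ti; rewrite D_new_t.
Qed.

Lemma partial_x_new_t p : U p -> partial 1 (t_comp T) p = 0.
Proof.
move=> Up; apply/eqP; apply: contraT => tx0; have Tp := UT Up.
set tx := partial 1 (t_comp T) p in tx0 *.
(* [y1] is the value of x' at which D T = T_t + x' T_x vanishes. *)
pose tt := partial 0 (t_comp T) p; pose y1 := - tt / tx.
(* [c] is the part of D D T at x' = [y1] that is free of x''; the choice of [w] then makes D D T
   equal to 1. *)
pose c := partial 0 (partial 0 (t_comp T)) p + y1 * partial 1 (partial 0 (t_comp T)) p
    + y1 * (partial 0 (partial 1 (t_comp T)) p + y1 * partial 1 (partial 1 (t_comp T)) p).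
pose w := (1 - c) / tx; pose js s := solution_jet 2 p (y1 + s) w.
have bj s : base (js s) = p by exact: solution_jet_base.
have x1 s : jet_x 1 (js s) = y1 + s by rewrite solution_jet_x // (leq_trans _ r3).
have x2 s : jet_x 2 (js s) = w by rewrite solution_jet_x.
have DTs s : DT (js s) = s * tx.
  by rewrite D_new_t ?bj // x1 -/tt -/tx /y1; field.
(* If D X vanished together with D T, both components would be stationary in the direction (1, y1),
   against the Jacobian condition. *)
have DX0 : D (new_x T 0) (js 0) != 0.
  have := tr_jacobian Tp; rewrite jacobian_point // -/tt -/tx; apply: contra_neq.
  rewrite D_new_x0 ?bj // x1 addr0 => H.
  have -> : partial 0 (x_comp T) p = - (y1 * partial 1 (x_comp T) p) by apply/eqP;
    rewrite -addr_eq0 H.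
  by rewrite /y1; field.
have DDT : D DT (js 0) = 1.
  by rewrite D_D_new_t ?bj // x1 x2 addr0 -/tx addrA addrAC -/c /w divfK // addrC subrK.
(* The pole order 2r - 1 of the r-th transformed derivative; [N i] is the i-th one multiplied by (D
   T)^e, with its denominator cancelled. *)
pose e := (2 * r.-1).+1.
pose N i j := (if i is i'.+1 then numer i' j * DT j ^+ (2 * (r.-1 - i')) else new_x T 0 j * DT j
  ^+ e).
(* The target equation multiplied by (D T)^e, in a form that makes sense at D T = 0. *)
pose H j := numer r.-1 j + \sum_(i < r) ode_a E' i (t_comp T p) * N i j - ode_b E' (t_comp T p) *
  DT j ^+ e.
have oW := open_base (@open_tr_dom _ T) (r := r).
have sDT := @smooth_DT _ r T.
have sH : smooth_on (lifted (tr_dom T)) H.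
  apply: smooth_sub => //; last by apply: smooth_mul; [|exact: smooth_cst|exact: smooth_exp].
  apply: smooth_add; [by []|exact: smooth_numer|apply: smooth_sum => // i _].
  apply: smooth_mul => //; first exact: smooth_cst.
  case: (val i) => [|i']; apply: smooth_mul => //; try exact: smooth_exp.
    exact: smooth_new_x0.
  exact: smooth_numer.
have Hs s : s != 0 -> H (js s) = 0.
  move=> s0; have ds : DT (js s) != 0 by rewrite DTs mulf_neq0.
  have Ps : prolong_dom T (js s) by split => //; rewrite bj.
  have := target_equation Up ds; rewrite -/(js s) => /(congr1 ( *%R^~ (DT (js s) ^+ e))).
  rewrite mulrDl mulr_suml => /eqP; rewrite -subr_eq0 => /eqP <-; rewrite /H; congr (_ + _ - _).
    have := @new_xE r.-1 _ Ps; rewrite (prednK r0) => ->.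
    by rewrite /e divfK // expf_neq0.
  apply: eq_bigr => i _; rewrite -mulrA; congr (_ * _); case: i => -[|i] //= ir.
  have -> : e = ((2 * (r.-1 - i)) + (2 * i).+1)%N.
    by rewrite /e addnS -mulnDr subnK // -ltnS prednK // ltnW.
  rewrite [LHS](_ : _ = new_x T i.+1 (js s) * DT (js s) ^+ (2 * (r.-1 - i) + (2 * i).+1)) //
    new_xE // exprD mulrA [in RHS]mulrAC divfK ?expf_neq0 //.
(* At s = 0 every term except the top numerator carries a positive power of D T. *)
have H0 : H (js 0) != 0.
  have D0 : DT (js 0) = 0 by rewrite DTs mul0r.
  rewrite /H D0 expr0n mulr0 subr0 big1 => [|i _].
    rewrite addr0 numer_DT0 // DDT expr1n mulr1 mulf_neq0 //.
    by apply/prodf_neq0 => i _; rewrite oppr_eq0 pnatr_eq0.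
  case: i => -[|i] //= ir; rewrite D0 expr0n ?mulr0 //.
  rewrite muln_eq0 /= subn_eq0 leqNgt -ltnS prednK // ir /= ?mulr0 //.
(* Along the family [H] vanishes for nonzero [s] but not at 0, which contradicts continuity. *)
have cH : {for 0, continuous (H \o js)}.
  apply: differentiable_continuous; apply: differentiable_comp; last first.
    by apply: smooth_diff sH _; rewrite /= bj.
  have -> : js = (fun s => js 0 + s *: (mkjet r 0 (fun i =>
    if i == r then - \sum_(i < r | i == 1%N :> nat) ode_a E i (tvar p) else (i == 1%N)%:R))).
    by apply/funext => s; rewrite /js addr0 solution_jet_line.
  by apply: differentiableD => //; exact: differentiableZl.
have nH : \forall s \near (0 : K)^', H (js s) != 0.
  by apply: cvg_within; apply: (cvgr_neq0 _ cH).
have [s [s0 Hsn]] : exists s : K, s != 0 /\ H (js s) != 0.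
  by apply: (@filter_ex _ (0 : K)^'); near=> s; split; near: s => //; exact: nbhs_dnbhs_neq.
by rewrite Hs ?eqxx in Hsn.
Unshelve. all: by end_near. Qed.

End Core.

(** * Affinity on the fibres *)

Section XLines.
Variables (K : numFieldType).
Local Notation point := 'rV[K]_2.
Implicit Types (p q : point) (u : point -> K).

Lemma tvar_mkpoint (t x : K) : tvar (mkpoint t x) = t.
Proof. by rewrite /tvar mxE. Qed.

Lemma xvar_mkpoint (t x : K) : xvar (mkpoint t x) = x.
Proof. by rewrite /xvar mxE. Qed.

Lemma mkpoint_eta p : mkpoint (tvar p) (xvar p) = p.
Proof. by apply: pointP; rewrite ?tvar_mkpoint ?xvar_mkpoint. Qed.

Lemma ball_point p q e : ball p e q <-> 0 < e /\ (ball (tvar p) e (tvar q) /\ ball (xvar p) e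
  (xvar q)).
Proof.
split=> [[e0 b]|[e0 [bt bx]]]; first by split => //; split; exact: b.
split=> // i j; rewrite (ord1 i); case: j => -[|[|j]] hj //.
  by rewrite (_ : Ordinal hj = 0) //; exact/val_inj.
by rewrite (_ : Ordinal hj = 1) //; exact/val_inj.
Qed.

Lemma is_derive_xline u (t x : K) : differentiable u (mkpoint t x) ->
  is_derive x 1 (fun x => u (mkpoint t x)) (partial 1 u (mkpoint t x)).
Proof.
move=> du; have du1 := @diff_derivable _ _ _ _ _ (delta_mx 0 1) du.
have E : (fun h : K => h^-1 *: (((fun x => u (mkpoint t x)) \o shift x) (h *: 1) - u (mkpoint t
  x)))
   = (fun h => h^-1 *: ((u \o shift (mkpoint t x)) (h *: delta_mx 0 1) - u (mkpoint t x))).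
  apply/funext => h; congr (_ *: (u _ - _)) => /=; apply: pointP.
    by rewrite /tvar !mxE /= mulr0 add0r.
  by rewrite /xvar !mxE /=.
by apply: DeriveDef; [rewrite /derivable E; exact: du1|rewrite /derive E].
Qed.

(** A ball of row vectors is a product of balls, so two of its points with the same t lie on a
    common disc in the x-direction inside it. *)
Lemma x_constant (R : realType) (rf : real_form R K) u p e :
  (forall q, ball p e q -> differentiable u q) -> (forall q, ball p e q -> partial 1 u q = 0) ->
  forall q q', ball p e q -> ball p e q' -> tvar q = tvar q' -> u q = u q'.
Proof.
move=> du u0 q q' /ball_point[e0 [qt qx]] /ball_point[_ [_ qx']] tqq.
have bb x : ball (xvar p) e x -> ball p e (mkpoint (tvar q) x).
  by move=> bx; apply/ball_point; rewrite tvar_mkpoint xvar_mkpoint.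
rewrite -(mkpoint_eta q) -(mkpoint_eta q') -tqq.
apply: (constant_on_ball rf (f := fun x => u (mkpoint (tvar q) x)) (c := xvar p) (e := e)) => //
  x /bb bx.
  by have [] := is_derive_xline (du _ bx).
by rewrite derive1E; have [_ ->] := is_derive_xline (du _ bx); exact: u0.
Qed.

(* The symmetry of second derivatives is avoided: locally u is a function of t alone. *)
Lemma partial_tx_eq0 (R : realType) (rf : real_form R K) u (U : set point) :
  open U -> (forall q, U q -> differentiable u q) -> (forall q, U q -> partial 1 u q = 0) ->
  forall q, U q -> partial 1 (partial 0 u) q = 0.
Proof.
move=> oU du u0 p Up.
have /nbhs_ballP[e /= e0 eU] : nbhs p U by exact: open_nbhs_nbhs.
pose f q := u (mkpoint (tvar q) (xvar p)).
have oB : open (ball p e) by exact: ball_open.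
have bp : ball p e p by exact: ballxx.
have uf q : ball p e q -> u q = f q.
  move=> bq; apply: (x_constant rf (p := p) (e := e)) => //; rewrite ?tvar_mkpoint //.
  - by move=> ? /eU; exact: du.
  - by move=> ? /eU; exact: u0.
  apply/ball_point; rewrite tvar_mkpoint xvar_mkpoint; move/ball_point: bq => [_ [bt _]].
  by do !split => //; exact: ballxx.
have fd : depends 0 f by move=> j j' jj; rewrite /f /tvar jj.
rewrite (partial_eq_on oB (g := partial 0 f)) //; last exact: (partial_eq_on oB _ uf).
by rewrite (partial_indep (m := 0) (depends_partial _ fd)).
Qed.

End XLines.

Section FibrePreserving.
Variables (K : numFieldType) (r : nat).
Local Notation jet := 'rV[K]_(r.+2).
Local Notation point := 'rV[K]_2.
Local Notation D := (@total_derivative K r).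
Local Notation lf u := (u \o @base K r).
Implicit Types (j : jet) (p : point) (u : point -> K).
Variables (T : transformation K 2) (U : set point).
Hypotheses (r0 : (0 < r)%N) (oU : open U) (UT : U `<=` tr_dom T).
Hypotheses (tx0 : forall p, U p -> partial 1 (t_comp T) p = 0)
  (ttx0 : forall p, U p -> partial 1 (partial 0 (t_comp T)) p = 0).
Local Notation DT := (D (new_t T)).
Local Notation W := (@base K r @^-1` U).
Local Notation Xx := (partial 1 (x_comp T)).
Local Notation Xt := (partial 0 (x_comp T)).
Local Notation Xxx := (partial 1 (partial 1 (x_comp T))).

Definition slope p := (partial 0 (t_comp T) p)^-1.
Definition lead k p := slope p ^+ k * Xx p.

Lemma t_comp_t_neq0 p : U p -> partial 0 (t_comp T) p != 0.
Proof.
move=> Up; have := tr_jacobian (UT Up); rewrite jacobian_point; last exact: UT.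
by rewrite tx0 // mulr0 subr0; apply: contra_neq => ->; rewrite mul0r.
Qed.

Lemma D_new_t_fibre j : W j -> DT j = partial 0 (t_comp T) (base j).
Proof. by move=> Wj; rewrite D_new_t //; [rewrite tx0 // mulr0 addr0|exact: UT]. Qed.

Lemma prolong_fibre j : W j -> prolong_dom T j.
Proof. by move=> Wj; split; [exact: UT|rewrite D_new_t_fibre // t_comp_t_neq0]. Qed.

Lemma smooth_t_compU : smooth_on U (t_comp T).
Proof. exact: (smooth_subset UT (smooth_t_comp (T := T))). Qed.

Lemma smooth_x_compU : smooth_on U (x_comp T).
Proof. exact: (smooth_subset UT (smooth_x_comp (T := T))). Qed.

Lemma smooth_slope : smooth_on U slope.
Proof.
apply: smooth_inv => //; first exact: t_comp_t_neq0.
by apply: smooth_partial; exact: smooth_t_compU.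
Qed.

Lemma smooth_lead k : smooth_on U (lead k).
Proof.
apply: smooth_mul => //; first by apply: smooth_exp => //; exact: smooth_slope.
by apply: smooth_partial; exact: smooth_x_compU.
Qed.

Lemma leadS k : lead k.+1 = slope \* lead k.
Proof. by apply/funext => p; rewrite /lead /= exprS mulrA. Qed.

(** T_tx = 0 makes [slope] independent of x, so only the factor X_x is differentiated. *)
Lemma lead_x k p : U p -> partial 1 (lead k) p = slope p ^+ k * Xxx p.
Proof.
move=> Up; elim: k => [|k IH].
  rewrite expr0 mul1r (_ : lead 0 = Xx) //.
  by apply/funext => q; rewrite /lead expr0 mul1r.
have ds : differentiable slope p := smooth_diff smooth_slope Up.
have dl : differentiable (lead k) p := smooth_diff (smooth_lead k) Up.
have slx : partial 1 slope p = 0.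
  have dt : differentiable (partial 0 (t_comp T)) p := smooth_diff (smooth_partial 0
    smooth_t_compU) Up.
  rewrite /slope /partial deriveV; [|exact: t_comp_t_neq0|exact: diff_derivable].
  by move: (ttx0 Up); rewrite {1}/partial => ->; rewrite scaler0.
rewrite leadS /partial deriveM; [|exact: diff_derivable..].
move: IH slx; rewrite /partial => -> ->.
by rewrite scaler0 addr0 /GRing.scale /= exprS mulrA.
Qed.

Lemma D_lf u j : smooth_on U u -> W j -> D (lf u) j = partial 0 u (base j) + jet_x 1 j * partial
  1 u (base j).
Proof. by move=> su Wj; rewrite D_lift //; exact: (smooth_diff su Wj). Qed.

Lemma open_lifted : open W. Proof. exact: open_base. Qed.

Lemma new_xS_fibre k j : W j -> new_x T k.+1 j = slope (base j) * D (new_x T k) j.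
Proof. by move=> Wj; rewrite /= mulrC /slope -(D_new_t_fibre Wj). Qed.

Lemma smooth_x k : smooth_on W (@jet_x K r k).
Proof. by apply: smooth_coord; exact: open_lifted. Qed.

Lemma depends_x m k : (k < m)%N -> (k <= r)%N -> depends m (@jet_x K r k).
Proof. by move=> km kr; apply: depends_coord; rewrite inordK. Qed.

(** The order is raised only where D falls on the highest derivative; all other terms go into [S],
    which by [depends k.+1] involves x^(k) at most. *)
Lemma new_x_lead k : (k < r)%N -> exists S : jet -> K,
  [/\ smooth_on W S, depends k.+1 S &
      forall j, W j -> new_x T k.+1 j = lead k.+1 (base j) * jet_x k.+1 j + S j].
Proof.
have ow := open_lifted; elim: k => [|k IH] kr.
  exists (lf (slope \* Xt)); split.
  - apply: smooth_lift => //; apply: smooth_mul => //; first exact: smooth_slope.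
    by apply: smooth_partial; exact: smooth_x_compU.
  - exact: depends_lift.
  move=> j Wj; rewrite new_xS_fibre // D_new_x0 //; last exact: UT.
  by rewrite /lead expr1 /=; ring.
have [S [sS dS ES]] := IH (ltnW kr).
exists (lf slope \* (D (lf (lead k.+1)) \* jet_x k.+1 \+ D S)); split.
- apply: smooth_mul => //; first by apply: smooth_lift => //; exact: smooth_slope.
  apply: smooth_add; [by []| |exact: smooth_D].
  apply: smooth_mul => //; last exact: smooth_x.
  by apply: smooth_D => //; apply: smooth_lift => //; exact: smooth_lead.
- apply: depends_mul; first by apply: depends_le (depends_lift _).
  apply: depends_add; last exact: depends_D.
  apply: depends_mul; last by apply: depends_x => //; exact: ltnW.
  exact: (@depends_le _ _ 2 k.+2 _ isT (depends_D (ltn0Sn 0) (depends_lift _))).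
move=> j Wj; rewrite new_xS_fibre //.
rewrite (D_eq ow (g := lf (lead k.+1) \* jet_x k.+1 \+ S)) //.
have sl : smooth_on W (lf (lead k.+1)) by apply: smooth_lift => //; exact: smooth_lead.
have dl := smooth_diff sl Wj.
have dx := smooth_diff (smooth_x k.+1) Wj.
rewrite D_add //; [|exact: differentiableM|exact: (smooth_diff sS Wj)].
by rewrite D_mul // D_x // (leadS k.+1) /=; ring.
Qed.

(** Applying slope D to the expansion of order k gives L_(k+1) = slope (D lead_k + L_k). The
    coefficient of x' in D lead_k is slope^k X_xx, so the integer factor grows by one at each step.
    The induction starts at order 3, the first one at which x^(k-1) differs from x'. *)
Lemma new_x_sublead n : (n.+2 < r)%N -> exists L R : jet -> K,
  [/\ smooth_on W L /\ smooth_on W R, depends 2 L, depends n.+2 R,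
      forall j, W j -> new_x T n.+3 j =
        lead n.+3 (base j) * jet_x n.+3 j + (L j * jet_x n.+2 j + R j) &
      forall j j', W j -> base j = base j' ->
        L j - L j' = n.+3%:R * (slope (base j) ^+ n.+3 * Xxx (base j)) * (jet_x 1 j - jet_x 1
          j')].
Proof.
have ow := open_lifted; have ss := smooth_slope; have slo := smooth_lead.
have sl u : smooth_on U u -> smooth_on W (lf u) by exact: smooth_lift.
have sp i u : smooth_on U u -> smooth_on U (partial i u) by exact: smooth_partial.
have d1 u : depends 1 (lf u) by exact: depends_lift.
have d12 u : depends 2 (lf u) by apply: depends_le (d1 u).
have d2 u : depends 2 (D (lf u)) by exact: depends_D.
elim: n => [|n IH] nr.
  have r1 : (1 < r)%N by apply: leq_trans nr.
  have r2 : (2 < r)%N by [].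
  (* At order 2 the lower terms are A + B x' + C x'^2. Differentiating the square contributes 2 C x'
     x'', which together with the share of D lead_2 makes up the factor 3. *)
  pose P := slope \* Xt.
  have sP : smooth_on U P by apply: smooth_mul => //; apply: sp; exact: smooth_x_compU.
  pose A := slope \* partial 0 P.
  pose B := slope \* (partial 1 P \+ partial 0 (lead 1)).
  pose C := slope \* partial 1 (lead 1).
  have sA : smooth_on U A by exact: (smooth_mul oU ss (sp _ _ sP)).
  have sB : smooth_on U B.
    by apply: (smooth_mul oU ss); apply: (smooth_add oU (sp _ _ sP) (sp _ _ (slo 1%N))).
  have sC : smooth_on U C by exact: (smooth_mul oU ss (sp _ _ (slo 1%N))).
  have x1 j : W j -> new_x T 1 j = (lf P \+ lf (lead 1) \* jet_x 1) j.
    move=> Wj; rewrite new_xS_fibre // D_new_x0 //; last exact: UT.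
    by rewrite /lead /P /= expr1; ring.
  have df (f : jet -> K) j : smooth_on W f -> W j -> differentiable f j by exact: smooth_diff.
  have x2 j : W j -> new_x T 2 j =
      (lf (lead 2) \* jet_x 2 \+ (lf A \+ (lf B \* jet_x 1 \+ (lf C \* jet_x 1) \* jet_x 1))) j.
    move=> Wj; rewrite new_xS_fibre // (D_eq ow x1) //.
    have e1 := df _ _ (sl _ sP) Wj; have e2 := df _ _ (sl _ (slo 1%N)) Wj.
    have e3 := df _ _ (smooth_x 1) Wj.
    have e4 := differentiableM e2 e3.
    rewrite (D_add e1 e4).
    rewrite (D_lf sP Wj).
    rewrite (D_mul e2 e3).
    rewrite D_x //.
    rewrite (D_lf (slo 1%N) Wj).
    rewrite (leadS 1) /A /B /C /=.
    have alg (s l p0 p1 l0 l1 x1' x2' : K) :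
      s * (p0 + x1' * p1 + ((l0 + x1' * l1) * x1' + l * x2')) =
      s * l * x2' + (s * p0 + (s * (p1 + l0) * x1' + s * l1 * x1' * x1')) by ring.
    exact: alg.
  exists (lf slope \* (D (lf (lead 2)) \+ (lf B \+ cst 2 \* (lf C \* jet_x 1)))).
  exists (lf slope \* (D (lf A) \+ (D (lf B) \* jet_x 1 \+ (D (lf C) \* jet_x 1) \* jet_x 1))).
  have sx1 := smooth_x 1.
  have dx : depends 2 (@jet_x K r 1) by exact: depends_x.
  split.
  - split; last exact: (smooth_mul ow (sl _ ss) (smooth_add ow (smooth_D ow (sl _ sA))
      (smooth_add ow (smooth_mul ow (smooth_D ow (sl _ sB)) sx1)
         (smooth_mul ow (smooth_mul ow (smooth_D ow (sl _ sC)) sx1) sx1)))).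
    exact: (smooth_mul ow (sl _ ss) (smooth_add ow (smooth_D ow (sl _ (slo 2%N)))
      (smooth_add ow (sl _ sB) (smooth_mul ow (smooth_cst ow 2) (smooth_mul ow (sl _ sC) sx1))))).
  - exact: (depends_mul (d12 _) (depends_add (d2 _)
      (depends_add (d12 _) (depends_mul (depends_cst 2) (depends_mul (d12 _) dx))))).
  - exact: (depends_mul (d12 _) (depends_add (d2 _)
      (depends_add (depends_mul (d2 _) dx) (depends_mul (depends_mul (d2 _) dx) dx)))).
  - move=> j Wj; rewrite new_xS_fibre // (D_eq ow x2) //.
    have e0 := df _ _ (sl _ (slo 2%N)) Wj; have e1 := df _ _ (sl _ sA) Wj.
    have e2 := df _ _ (sl _ sB) Wj; have e3 := df _ _ (sl _ sC) Wj.
    have e4 := df _ _ (smooth_x 1) Wj; have e5 := df _ _ (smooth_x 2) Wj.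
    have e6 := differentiableM e3 e4; have e7 := differentiableM e6 e4.
    have e8 := differentiableM e2 e4; have e9 := differentiableM e0 e5.
    have e10 := differentiableD e8 e7; have e11 := differentiableD e1 e10.
    rewrite (D_add e9 e11).
    rewrite (D_add e1 e10) (D_add e8 e7) (D_mul e0 e5) (D_mul e2 e4) (D_mul e6 e4) (D_mul e3 e4)
      !D_x // (leadS 2) /=.
    have -> : ((lf C : jet -> K) * jet_x 1) j = C (base j) * jet_x 1 j by [].
    have alg (s l dl dA dB dC b c x1' x2' x3' : K) :
      s * (dl * x2' + l * x3' + (dA + (dB * x1' + b * x2' + ((dC * x1' + c * x2') * x1' + c * x1'
        * x2')))) =
      s * l * x3' + (s * (dl + (b + 2 * (c * x1'))) * x2' + s * (dA + (dB * x1' + dC * x1' *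
        x1'))).
      by ring.
    exact: alg.
  - move=> j j' Wj bj; have Wj' : W j' by rewrite /= -bj.
    rewrite /= (D_lf (slo 2%N) Wj) (D_lf (slo 2%N) Wj') -bj (lead_x 2 Wj) /C /= (lead_x 1 Wj)
      expr1.
    have alg (s d x y b z : K) : s * (d + y * (s ^+ 2 * x) + (b + 2 * (s * (s * x) * y))) -
        s * (d + z * (s ^+ 2 * x) + (b + 2 * (s * (s * x) * z))) = 3 * (s ^+ 3 * x) * (y - z).
      by ring.
    exact: alg.
have [L [R [[sL sR] dL dR EL EM]]] := IH (ltnW nr).
exists (lf slope \* (D (lf (lead n.+3)) \+ L)).
exists (lf slope \* (D L \* jet_x n.+2 \+ D R)).
split.
- split; last exact: (smooth_mul ow (sl _ ss) (smooth_add ow (smooth_mul ow (smooth_D ow sL)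
      (smooth_x n.+2)) (smooth_D ow sR))).
  exact: (smooth_mul ow (sl _ ss) (smooth_add ow (smooth_D ow (sl _ (slo n.+3))) sL)).
- exact: (depends_mul (d12 _) (depends_add (d2 _) dL)).
- apply: depends_mul; first by apply: depends_le (d1 _).
  apply: depends_add; last exact: (depends_D _ dR).
  apply: depends_mul; last by apply: depends_x => //; exact/ltnW/ltnW.
  by apply: depends_le (depends_D _ dL).
- move=> j Wj; rewrite new_xS_fibre // (D_eq ow (g := lf (lead n.+3) \* jet_x n.+3 \+ (L \* jet_x
  n.+2 \+ R))) //.
  have e0 := smooth_diff (sl _ (slo n.+3)) Wj; have e1 := smooth_diff sL Wj.
  have e2 := smooth_diff sR Wj; have e3 := smooth_diff (smooth_x n.+3) Wj.
  have e4 := smooth_diff (smooth_x n.+2) Wj.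
  have e5 := differentiableM e0 e3; have e6 := differentiableM e1 e4.
  have e7 := differentiableD e6 e2.
  rewrite (D_add e5 e7) (D_add e6 e2) (D_mul e0 e3) (D_mul e1 e4) !D_x //; last exact: ltnW.
  rewrite (leadS n.+3) /=.
  have alg (s l dl x y z a dL' dR' : K) :
    s * (dl * x + l * y + (dL' * z + a * x + dR')) = s * l * y + (s * (dl + a) * x + s * (dL' * z
      + dR')).
    by ring.
  exact: alg.
- move=> j j' Wj bj; have Wj' : W j' by rewrite /= -bj.
  have := EM j j' Wj bj.
  rewrite /= (D_lf (slo n.+3) Wj) (D_lf (slo n.+3) Wj') -bj (lead_x n.+3 Wj).
  move=> /eqP; rewrite subr_eq => /eqP ->.
  rewrite -[n.+4%:R]natr1 [slope _ ^+ n.+4]exprS.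
  have alg (s q x d y z l n' : K) : s * (d + y * (q * x) + (n' * (q * x) * (y - z) + l)) -
      s * (d + z * (q * x) + l) = (n' + 1) * (s * q * x) * (y - z) by ring.
  exact: alg.
Qed.

End FibrePreserving.

Section Affine.
Variables (R : realType) (K : numFieldType) (rf : real_form R K) (r : nat).
Variables (T : transformation K 2) (E E' : linear_ode K r) (U : set 'rV[K]_2).
Hypotheses (r3 : (3 <= r)%N) (oU : open U) (UT : U `<=` tr_dom T) (TE : maps_ode T U E E').

Lemma partial_xx_new_x p : U p -> partial 1 (partial 1 (x_comp T)) p = 0.
Proof.
move=> Up; case: r r3 E E' TE => [|[|[|n]]] // _ F F' TF.
have r0 : (0 < n.+3)%N by [].
have tx0 := partial_x_new_t (isT : (3 <= n.+3)%N) UT TF.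
have ttx0 := partial_tx_eq0 rf oU (fun q Uq => smooth_diff (smooth_t_comp (T := T)) (UT Uq)) tx0.
have [S [_ dS ES]] := @new_x_lead K n.+3 T U r0 oU UT tx0 n.+1 (ltnW (ltnSn _)).
have [L [Q [_ dL dQ ELQ EL]]] := @new_x_sublead K n.+3 T U r0 oU UT tx0 ttx0 n (ltnSn _).
(* Now r = n + 3, so [w] is the value of x^(r-1), a coordinate other than x'. *)
pose J (y w : K) := solution_jet F n.+2 p y w.
have bJ y w : base (J y w) = p by exact: solution_jet_base.
have x1 y w : jet_x 1 (J y w) = y by rewrite solution_jet_x.
have eq y w : new_x T n.+3 (J y w) + \sum_(i < n.+3) ode_a F' i (t_comp T p) * new_x T i (J y w)
    = ode_b F' (t_comp T p).
  have WJ : U (base (J y w)) by rewrite bJ.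
  have [_ dJ] := prolong_fibre r0 UT tx0 WJ.
  exact: (target_equation (isT : (3 <= n.+3)%N) UT TF Up dJ).
have same_low m f y w w' : depends m f -> (m <= n.+2)%N -> f (J y w) = f (J y w').
  move=> df mn; apply: df => i im; rewrite !mxE; case: i im => -[|i] //= ir im.
  have ilt : (i < n.+2)%N by apply: leq_trans im mn.
  rewrite (ltn_eqF (ltn_trans ilt (ltnSn _))) /coords; do 2!case: ifP => // _.
  by rewrite (ltn_eqF ilt).
(* The mixed second difference annihilates functions of [y] alone and functions of [w] alone. *)
pose M (f : 'rV[K]_(n.+3.+2) -> K) := f (J 1 1) - f (J 1 0) - f (J 0 1) + f (J 0 0).
have M_low m f : depends m f -> (m <= n.+2)%N -> M f = 0.
  move=> df mn; rewrite /M (same_low _ _ 1 1 0 df mn) (same_low _ _ 0 1 0 df mn).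
  by rewrite subrr sub0r addNr.
have W y w : U (base (J y w)) by rewrite bJ.
have xn2 y w : jet_x n.+2 (J y w) = w by rewrite solution_jet_x // /coords /= eqxx.
(* On the source equation x^(r) is affine in the remaining coordinates, so it has no mixed term. *)
have M_top : M (jet_x n.+3) = 0.
  have E0 y w : jet_x n.+3 (J y w) = ode_b F (tvar p) -
      \sum_(i < n.+3) ode_a F i (tvar p) * coords n.+2 p y w i.
    by rewrite jet_x_mkjet // eqxx.
  rewrite /M !E0.
  have alg (b s1 s2 s3 s4 : K) : b - s1 - (b - s2) - (b - s3) + (b - s4) = - (s1 - s2 - s3 + s4)
    by ring.
  rewrite alg -!sumrB -big_split /= big1 ?oppr0 // => i _.
  rewrite -!mulrBr -mulrDr (_ : _ - _ - _ + _ = 0) ?mulr0 //.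
  have H (b0 b1 b2 : bool) (x : K) (c := fun y w => if b0 then x else if b1 then y else if b2
    then w else 0) :
    c 1 1 - c 1 0 - c 0 1 + c 0 0 = 0.
    by rewrite {}/c; case: b0; [ring|case: b1; [ring|case: b2; ring]].
  exact: H.
(* For i = r - 1 the factor of [w] depends on the base point only; for smaller i, [w] does not
   occur. *)
have M_lin i : (i < n.+3)%N -> M (new_x T i) = 0.
  rewrite ltnS leq_eqVlt => /orP[/eqP ->|ilt]; last exact: (M_low _ _ (@depends_new_x K n.+3 T i)
    ilt).
  rewrite /M !ES // !bJ !xn2; have := M_low _ _ dS (leqnn _); rewrite /M => MS.
  by rewrite -[RHS]MS; ring.
have M0 : M (new_x T n.+3) = 0.
  pose s y w := \sum_(i < n.+3) ode_a F' i (t_comp T p) * new_x T i (J y w).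
  have e y w : new_x T n.+3 (J y w) = ode_b F' (t_comp T p) - s y w by rewrite -(eq y w) addrK.
  have s0 : s 1 1 - s 1 0 - s 0 1 + s 0 0 = 0.
    rewrite /s -!sumrB -big_split /= big1 // => i _.
    by have := M_lin i (ltn_ord i); rewrite /M -!mulrBr -mulrDr => ->; rewrite mulr0.
  have alg (b s1 s2 s3 s4 : K) : b - s1 - (b - s2) - (b - s3) + (b - s4) = - (s1 - s2 - s3 + s4)
    by ring.
  by rewrite /M !e alg s0 oppr0.
have LW y : L (J y 1) = L (J y 0) by exact: same_low dL _.
(* Of the expansion of order r only the term with x^(r-1) has a mixed difference, namely r slope^r
   X_xx. *)
have := M0; rewrite /M !ELQ // !bJ !xn2 !LW.
have Q0 := M_low _ _ dQ (leqnn _); rewrite /M in Q0; rewrite /M in M_top.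
have alg (l a11 a10 a01 a00 b1 b0 c11 c10 c01 c00 : K) :
   l * a11 + (b1 * 1 + c11) - (l * a10 + (b1 * 0 + c10)) - (l * a01 + (b0 * 1 + c01)) + (l * a00
     + (b0 * 0 + c00))
   = l * (a11 - a10 - a01 + a00) + (b1 - b0) + (c11 - c10 - c01 + c00) by ring.
rewrite alg M_top Q0 mulr0 add0r addr0 EL ?bJ // !x1 subr0 mulr1 => /eqP.
rewrite mulf_eq0 pnatr_eq0 /= mulf_eq0 expf_eq0 /= invr_eq0 (negbTE (t_comp_t_neq0 UT tx0 Up)) =>
  /eqP.
by [].
Qed.

End Affine.

(** * Fibre-affine transformations *)

Section FibreAffine.
Variables (K : numFieldType).
Local Notation point := 'rV[K]_2.
Implicit Types (p q : point) (u : point -> K).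

Definition fibre_affine_at (T : transformation K 2) p0 :=
  exists (U : set 'rV[K]_2) (I : set K) (tau X1 X0 : K -> K),
      [/\ open U /\ U p0, open I,
          [/\ smooth1_on I tau, smooth1_on I X1 & smooth1_on I X0],
          forall t, I t -> derive1 tau t * X1 t != 0
        & forall p, U p ->
            [/\ I (tvar p), tvar (T p) = tau (tvar p)
              & xvar (T p) = X1 (tvar p) * xvar p + X0 (tvar p)]].

Lemma is_derive_tline u (t x : K) : differentiable u (mkpoint t x) ->
  is_derive t 1 (fun t => u (mkpoint t x)) (partial 0 u (mkpoint t x)).
Proof.
move=> du; have du1 := @diff_derivable _ _ _ _ _ (delta_mx 0 0) du.
have E : (fun h : K => h^-1 *: (((fun t => u (mkpoint t x)) \o shift t) (h *: 1) - u (mkpoint t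
  x)))
   = (fun h => h^-1 *: ((u \o shift (mkpoint t x)) (h *: delta_mx 0 0) - u (mkpoint t x))).
  apply/funext => h; congr (_ *: (u _ - _)) => /=; apply: pointP.
    by rewrite /tvar !mxE /=.
  by rewrite /xvar !mxE /= mulr0 add0r.
by apply: DeriveDef; [rewrite /derivable E; exact: du1|rewrite /derive E].
Qed.

Lemma smooth1_tline (I : set K) (U : set point) u x : open I -> smooth_on U u ->
  (forall t, I t -> U (mkpoint t x)) -> smooth1_on I (fun t => u (mkpoint t x)).
Proof.
move=> oI su IU; apply: (smooth1_comp oI IU su) => k.
have [k0|k0] := eqVneq k 0.
  by apply: (smooth1_eq oI (f := id)); [move=> t _; rewrite mxE k0|exact: smooth1_id].
by apply: (smooth1_eq oI (f := cst x)); [move=> t _; rewrite mxE (negbTE k0)|exact: smooth1_cst].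
Qed.

Lemma fibre_affine_atP (R : realType) (rf : real_form R K) (T : transformation K 2) (U : set
  point) :
  open U -> U `<=` tr_dom T -> (forall p, U p -> partial 1 (t_comp T) p = 0) ->
  (forall p, U p -> partial 1 (partial 1 (x_comp T)) p = 0) ->
  forall p, U p -> fibre_affine_at T p.
Proof.
move=> oU UT tx0 xx0 p Up.
have /nbhs_ballP[e /= e0 eU] : nbhs p U by exact: open_nbhs_nbhs.
pose x0 := xvar p; pose I := ball (tvar p) e.
have oI : open I by exact: ball_open.
have IB t x : I t -> ball x0 e x -> ball p e (mkpoint t x).
  by move=> It bx; apply/ball_point; rewrite tvar_mkpoint xvar_mkpoint.
have IU t : I t -> U (mkpoint t x0) by move=> It; apply/eU/IB => //; exact: ballxx.
have st : smooth_on U (t_comp T) := smooth_subset UT (smooth_t_comp (T := T)).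
have sx : smooth_on U (x_comp T) := smooth_subset UT (smooth_x_comp (T := T)).
have sX : smooth_on U (partial 1 (x_comp T)) := smooth_partial 1 sx.
have sc : smooth_on U (fun q => q 0 1) := smooth_coord oU 1.
have sY : smooth_on U (x_comp T \- partial 1 (x_comp T) \* (fun q => q 0 1)).
  exact: (smooth_sub oU sx (smooth_mul oU sX sc)).
(* The candidate X - x X_x for X0; its x-derivative is -x X_xx = 0, so its values on the line x =
   [x0] determine it. *)
pose u := x_comp T \- partial 1 (x_comp T) \* (fun q => q 0 1).
exists (ball p e), I, (fun t => t_comp T (mkpoint t x0)), (fun t => partial 1 (x_comp T) (mkpoint
  t x0)),
  (fun t => u (mkpoint t x0)).
split=> //.
- by split; [exact: ball_open|exact: ballxx].
- by split; [exact: (smooth1_tline oI st IU)|exact: (smooth1_tline oI sX IU)|exact: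
  (smooth1_tline oI sY IU)].
- move=> t /IU Ut; rewrite derive1E; have [_ ->] := is_derive_tline (smooth_diff st Ut).
  have := tr_jacobian (UT _ Ut); rewrite jacobian_point; last exact: UT.
  by rewrite tx0 // mulr0 subr0.
move=> q bq; have /ball_point[_ [It bx]] := bq.
have bq0 : ball p e (mkpoint (tvar q) x0) by apply: IB => //; exact: ballxx.
have const (v : point -> K) : smooth_on U v -> (forall q, U q -> partial 1 v q = 0) -> v q = v
  (mkpoint (tvar q) x0).
  move=> sv v0; apply: (x_constant rf (p := p) (e := e)) => //; rewrite ?tvar_mkpoint //.
    by move=> ? /eU; exact: (smooth_diff sv).
  by move=> ? /eU; exact: v0.
split => //; first exact: (const (t_comp T)).
have cX := const _ sX xx0.
suff cY : u q = u (mkpoint (tvar q) x0).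
  suff : x_comp T q = partial 1 (x_comp T) (mkpoint (tvar q) x0) * xvar q + u (mkpoint (tvar q)
    x0) by [].
  by rewrite -cX -cY /u /= /xvar addrC subrK.
apply: (const u sY).
move=> r Ur; have dc := smooth_diff sc Ur; have dX := smooth_diff sX Ur.
rewrite /partial deriveB; [|exact/diff_derivable/(smooth_diff sx
  Ur)|exact/diff_derivable/differentiableM].
rewrite deriveM; [|exact: diff_derivable..].
have := partial_coord 1 1 r; have := xx0 _ Ur; rewrite /partial => -> ->.
by rewrite scaler0 addr0 /GRing.scale /= mulr1 subrr.
Qed.

Lemma maps_ode_fibre_affine (R : realType) (rf : real_form R K) r (r3 : (3 <= r)%N)
    (T : transformation K 2) (U : set point) (E E' : linear_ode K r) :
  open U -> U `<=` tr_dom T -> maps_ode T U E E' -> forall p, U p -> fibre_affine_at T p.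
Proof.
move=> oU UT TE; apply: (fibre_affine_atP rf oU UT).
  exact: (partial_x_new_t r3 UT TE).
exact: (partial_xx_new_x rf r3 oU UT TE).
Qed.

End FibreAffine.

Section PartialAffine.
Variables (K : numFieldType) (n : nat).

Lemma partial_affine (f : 'rV[K]_n -> K) (i : 'I_n) z c :
  (forall h, f (h *: delta_mx 0 i + z) = f z + h * c) -> partial i f z = c.
Proof.
move=> fE; rewrite /partial /derive; apply: cvg_lim => //.
apply: (@cvg_trans _ (cst c @ (0 : K)^')); last exact: cvg_cst.
apply: near_eq_cvg; near=> h; rewrite /= fE addrAC subrr add0r /GRing.scale /= mulKf //.
by near: h; exact: nbhs_dnbhs_neq.
Unshelve. all: by end_near. Qed.

End PartialAffine.

(** * Prolongation of fibre-affine transformations *)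

Section AffineProlongation.
Variables (K : numFieldType) (r : nat).
Local Notation jet := 'rV[K]_(r.+2).
Local Notation point := 'rV[K]_2.
Local Notation D := (@total_derivative K r).
Implicit Types (j : jet) (p : point).
Variables (T : transformation K 2) (U : set point) (I : set K) (tau X1 X0 : K -> K).
Hypotheses (r0 : (0 < r)%N) (oU : open U) (UT : U `<=` tr_dom T) (oI : open I).
Hypotheses (stau : smooth1_on I tau) (sX1 : smooth1_on I X1) (sX0 : smooth1_on I X0).
Hypothesis (nz : forall t, I t -> derive1 tau t * X1 t != 0).
Hypothesis (rep : forall p, U p ->
  [/\ I (tvar p), tvar (T p) = tau (tvar p) & xvar (T p) = X1 (tvar p) * xvar p + X0 (tvar p)]).
Local Notation W := (@base K r @^-1` U).

Lemma dtau_neq0 t : I t -> derive1 tau t != 0.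
Proof. by move=> It; apply: contra_neq (nz It) => ->; rewrite mul0r. Qed.

Lemma X1_neq0 t : I t -> X1 t != 0.
Proof. by move=> It; apply: contra_neq (nz It) => ->; rewrite mulr0. Qed.

(** The entries c_ki. The recursion stems from D (c x^(i)) = c' x^(i) + c x^(i+1) and the division
    by D T = tau'. *)
Fixpoint xcoef k i : K -> K :=
  if k is k'.+1 then fun t =>
    (derive1 (xcoef k' i) t + (if i is i'.+1 then xcoef k' i' t else 0)) / derive1 tau t
  else if i is 0%N then X1 else cst 0.

Fixpoint ccoef k : K -> K :=
  if k is k'.+1 then fun t => derive1 (ccoef k') t / derive1 tau t else X0.

Lemma smooth1_derivable f t : smooth1_on I f -> I t -> derivable f t 1.
Proof. by move=> sf It; exact: (sf 0%N). Qed.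

Lemma smooth1_dtauV : smooth1_on I (fun t => (derive1 tau t)^-1).
Proof. exact: (smooth1_inv oI dtau_neq0 (smooth1_derive1 stau)). Qed.

Lemma smooth_xcoef k i : smooth1_on I (xcoef k i).
Proof.
elim: k i => [|k IH] [|i].
- exact: sX1.
- exact: (@smooth1_cst _ I 0 oI).
- exact: (smooth1_mul oI (smooth1_add oI (smooth1_derive1 (IH 0%N)) (@smooth1_cst _ I 0 oI))
  smooth1_dtauV).
- exact: (smooth1_mul oI (smooth1_add oI (smooth1_derive1 (IH i.+1)) (IH i)) smooth1_dtauV).
Qed.

Lemma smooth_ccoef k : smooth1_on I (ccoef k).
Proof.
elim: k => [|k IH]; first exact: sX0.
exact: (smooth1_mul oI (smooth1_derive1 IH) smooth1_dtauV).
Qed.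

Lemma xcoef_gt k i : (k < i)%N -> xcoef k i = cst 0.
Proof.
elim: k i => [|k IH] [|i] // ki; apply/funext => t.
by rewrite [LHS]/= (IH i.+1 (ltnW ki)) (IH i ki) derive1_cst addr0 mul0r.
Qed.

Lemma xcoef_diag k t : I t -> xcoef k k t != 0.
Proof.
move=> It; elim: k => [|k IH] /=; first exact: X1_neq0.
rewrite (xcoef_gt (ltnSn k)) derive1_cst add0r mulf_neq0 // invr_neq0 //.
exact: dtau_neq0.
Qed.

Lemma lifted_time j : W j -> I (jet_t j).
Proof. by move=> Wj; rewrite -tvar_base; have [] := rep Wj. Qed.

Lemma differentiable_tfun (f : K -> K) j : derivable f (jet_t j) 1 ->
  differentiable (fun j : jet => f (jet_t j)) j.
Proof.
move=> /derivable1_diffP df.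
rewrite (_ : (fun _ => _) = f \o (fun j : jet => j 0 0)) //.
by apply: differentiable_comp => //; exact: differentiable_coord.
Qed.

Lemma D_tfun (f : K -> K) j : derivable f (jet_t j) 1 ->
  D (fun j : jet => f (jet_t j)) j = derive1 f (jet_t j).
Proof.
move=> df; rewrite /total_derivative big1 => [|k _]; last first.
  rewrite (partial_indep (m := 0)) ?mulr0 //; last by rewrite inordK // !ltnS ltnW.
  by move=> i i' ii; rewrite /jet_t ii.
rewrite addr0 /partial /derive /derive1.
set a := (fun h : K => _); set b := (fun h : K => _); suff -> : a = b by [].
by apply/funext => h; rewrite /a /b /= /jet_t !mxE !eqxx mulr1.
Qed.

Lemma D_sum n (F : 'I_n -> jet -> K) j : (forall i, differentiable (F i) j) ->
  D (fun j => \sum_(i < n) F i j) j = \sum_(i < n) D (F i) j.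
Proof.
elim: n F => [|n IH] F dF.
  rewrite big_ord0 (_ : (fun _ => _) = cst 0) ?D_cst //.
  by apply/funext => i; rewrite big_ord0.
rewrite big_ord_recr /= -IH // -D_add //.
- congr (D _ j); apply/funext => i; by rewrite big_ord_recr.
- rewrite (_ : (fun _ => _) = \sum_(i < n) F (widen_ord (leqnSn n) i)); last first.
    by apply/funext => i; rewrite fct_sumE.
  exact: differentiable_sum.
Qed.

Lemma D_new_t_affine j : W j -> D (new_t T) j = derive1 tau (jet_t j).
Proof.
move=> Wj; rewrite (D_eq (open_base oU) (g := fun j : jet => tau (jet_t j))) //.
  by apply: D_tfun; exact: (smooth1_derivable stau (lifted_time Wj)).
by move=> i Wi; rewrite /new_t -tvar_base; have [] := rep Wi.
Qed.

Lemma lifted_prolong_dom j : W j -> prolong_dom T j.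
Proof. by move=> Wj; split; [exact: UT|rewrite D_new_t_affine //;
  exact: dtau_neq0 (lifted_time Wj)]. Qed.

Definition affine_form k j := \sum_(i < k.+1) xcoef k i (jet_t j) * jet_x i j + ccoef k (jet_t j).

Lemma new_x_affine k j : (k <= r)%N -> W j -> new_x T k j = affine_form k j.
Proof.
elim: k j => [|k IH] j kr Wj.
  rewrite /affine_form big_ord1 /= -tvar_base -xvar_base.
  by have [_ _ ->] := rep Wj.
rewrite [LHS]/= D_new_t_affine //.
rewrite (D_eq (open_base oU) (g := affine_form k)) //; last by move=> i Wi;
  exact: IH (ltnW kr) Wi.
have It := lifted_time Wj.
have dc i : differentiable (fun j : jet => xcoef k i (jet_t j)) j.
  by apply: differentiable_tfun; exact: (smooth1_derivable (@smooth_xcoef k i) It).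
have dx i : differentiable (@jet_x K r i) j by exact: differentiable_coord.
have dF (i : 'I_k.+1) : differentiable ((fun j : jet => xcoef k i (jet_t j)) \* jet_x i) j.
  exact: differentiableM.
have dd : differentiable (fun j : jet => ccoef k (jet_t j)) j.
  by apply: differentiable_tfun; exact: (smooth1_derivable (@smooth_ccoef k) It).
rewrite (D_add (f := fun j : jet => \sum_(i < k.+1) xcoef k i (jet_t j) * jet_x i j)) //;
  last first.
  rewrite (_ : (fun _ => _) = \sum_(i < k.+1) ((fun j : jet => xcoef k i (jet_t j)) \* jet_x i));
    last first.
    by apply/funext => i; rewrite fct_sumE.
  exact: differentiable_sum.
rewrite (D_sum dF) D_tfun; last exact: (smooth1_derivable (@smooth_ccoef k) It).
rewrite (eq_bigr (fun i : 'I_k.+1 => derive1 (xcoef k i) (jet_t j) * jet_x i j + xcoef k i (jet_t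
  j) * jet_x i.+1 j)); last first.
  move=> i _; rewrite D_mul // D_tfun; last exact: (smooth1_derivable (@smooth_xcoef k i) It).
  by rewrite D_x // (leq_trans (ltn_ord i)).
rewrite /affine_form big_split /= mulrDl mulrDl; congr (_ + _).
(* The sums with c' and with shifted indices run over 0..k and 1..k+1; they are extended to 0..k+1
   by c_(k,k+1) = 0 and by the default value at i = 0. *)
under [RHS]eq_bigr => i _ do rewrite mulrAC mulrDl.
rewrite -mulr_suml big_split /= -mulrDl; congr ((_ + _) / _).
  by rewrite [RHS]big_ord_recr /= xcoef_gt // derive1_cst mul0r addr0.
by rewrite [RHS]big_ord_recl mul0r add0r.
Qed.

(** The link between c_ki, which belongs to a local representation, and [symbol], which is defined
    from [T]. *)
Lemma partial_new_x k i j : (k <= r)%N -> (i <= r)%N -> W j ->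
  partial (inord i.+1) (new_x T k) j = xcoef k i (jet_t j).
Proof.
move=> kr ir Wj.
rewrite (partial_eq_on (open_base oU) (g := affine_form k)) //; last by move=> q Wq;
  exact: new_x_affine.
apply: partial_affine => h; rewrite /affine_form.
have -> : jet_t (h *: delta_mx 0 (inord i.+1) + j) = jet_t j.
  by rewrite /jet_t !mxE /= -val_eqE /= inordK ?andbF ?mulr0 ?add0r.
have xE l : (l <= r)%N -> jet_x l (h *: delta_mx 0 (inord i.+1) + j) = jet_x l j + h * (l ==
  i)%:R.
  by move=> lr; rewrite /jet_x !mxE /= -val_eqE /= !inordK // eqSS addrC.
rewrite (eq_bigr (fun l : 'I_k.+1 => xcoef k l (jet_t j) * jet_x l j + h * (xcoef k l (jet_t j) *
  (l == i :> nat)%:R))).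
  rewrite big_split /= -mulr_sumr addrAC -[LHS]addrA -[RHS]addrA; congr (_ + (_ + _ * _)).
  have [ki|ik] := ltnP k i.
    rewrite xcoef_gt // big1 // => l _.
    by rewrite (ltn_eqF (leq_ltn_trans _ ki)) ?mulr0 // -ltnS.
  rewrite (bigD1 (Ordinal (ik : (i < k.+1)%N))) //= eqxx mulr1 big1 ?addr0 // => l.
  by rewrite -val_eqE /= => /negbTE ->; rewrite mulr0.
move=> l _; rewrite xE; last by apply: leq_trans kr; rewrite -ltnS.
by rewrite mulrDr; congr (_ + _); rewrite mulrCA.
Qed.

Lemma partial_new_t_x i j : (i <= r)%N -> W j -> partial (inord i.+1) (new_t T) j = 0.
Proof.
move=> ir Wj; rewrite (partial_eq_on (open_base oU) (g := fun j : jet => tau (jet_t j))) //.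
  rewrite (partial_indep (m := 0)) // ?inordK //.
  by move=> q q' qq; rewrite /jet_t qq.
by move=> q Wq; rewrite /new_t -tvar_base; have [] := rep Wq.
Qed.

Lemma partial_new_t_t j : W j -> partial 0 (new_t T) j != 0.
Proof.
move=> Wj; have := dtau_neq0 (lifted_time Wj); rewrite -D_new_t_affine // /total_derivative big1
  ?addr0 // => k _.
by rewrite partial_new_t_x ?mulr0 // ltnW.
Qed.

End AffineProlongation.

(** * The lift to the joint space *)

Section SubmxPartial.
Variables (K : numFieldType) (m n : nat).
Implicit Type z : 'rV[K]_(m + n).

Lemma lsubmx_shiftl (i : 'I_m) h z :
  lsubmx (h *: delta_mx 0 (lshift n i) + z) = h *: delta_mx 0 i + lsubmx z.
Proof. by apply/rowP => k; rewrite !mxE eq_lshift. Qed.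

Lemma lsubmx_shiftr (i : 'I_n) h z : lsubmx (h *: delta_mx 0 (rshift m i) + z) = lsubmx z.
Proof. by apply/rowP => k; rewrite !mxE eq_lrshift andbF mulr0 add0r. Qed.

Lemma rsubmx_shiftr (i : 'I_n) h z :
  rsubmx (h *: delta_mx 0 (rshift m i) + z) = h *: delta_mx 0 i + rsubmx z.
Proof. by apply/rowP => k; rewrite !mxE eq_rshift. Qed.

Lemma partial_lsubmx (f : 'rV[K]_m -> K) (i : 'I_m) z :
  partial (lshift n i) (f \o lsubmx) z = partial i f (lsubmx z).
Proof.
rewrite /partial /derive.
set a := (fun h : K => _); set b := (fun h : K => _); suff -> : a = b by [].
by apply/funext => h; rewrite /a /b /= lsubmx_shiftl.
Qed.

Lemma smooth_lsubmx (W : set 'rV[K]_m) (f : 'rV[K]_m -> K) : open W -> smooth_on W f ->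
  open [set z : 'rV[K]_(m + n) | W (lsubmx z)] /\
  smooth_on [set z : 'rV[K]_(m + n) | W (lsubmx z)] (f \o lsubmx).
Proof.
move=> oW sf; have oZ : open [set z : 'rV[K]_(m + n) | W (lsubmx z)].
  apply: (@open_comp _ _ (lsubmx : 'rV[K]_(m + n) -> 'rV[K]_m)) => // z _.
  exact: (differentiable_continuous (differentiable_lsubmx z)).
split=> //; apply: (smooth_comp oZ _ sf) => // k.
by apply: (smooth_on_eq oZ (f := fun z => z 0 (lshift n k))) => [z _|];
  [rewrite mxE|exact: smooth_coord].
Qed.

End SubmxPartial.

Section Prolonged.
Variables (K : numFieldType) (r : nat) (T : transformation K 2).
Local Notation jet := 'rV[K]_(r.+2).
Local Notation joint := 'rV[K]_(r.+2 + (r + 1)).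
Local Notation P := (@prolong_dom K r T).
Implicit Types (j : jet) (z : joint).

Definition symbol k i j := partial (inord i.+1) (@new_x K r T k) j.
Definition symbol_mx j : 'M[K]_r := \matrix_(k < r, i < r) symbol k i j.
Definition symbol_row j : 'rV[K]_r := \row_(i < r) symbol r i j.

(* The solution of a' C + c = c_rr a. *)
Definition new_a z : 'rV[K]_r :=
  (symbol r r (lsubmx z) *: lsubmx (rsubmx z) - symbol_row (lsubmx z)) *m invmx (symbol_mx
    (lsubmx z)).

(** Chosen so that the residual of the new equation at the prolonged jet is c_rr times the residual
    of the old one, at every jet and not only on solutions. By [new_bE] the jet enters only through
    t. *)
Definition new_b z : K :=
  new_x T r (lsubmx z) + \sum_(k < r) new_a z 0 k * new_x T k (lsubmx z)
  - symbol r r (lsubmx z) * (jet_x r (lsubmx z) +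
      \sum_(i < r) lsubmx (rsubmx z) 0 i * jet_x i (lsubmx z) - rsubmx (rsubmx z) 0 0).

Definition joint_dom : set joint := [set z | P (lsubmx z)].

Definition joint_map z : joint :=
  row_mx (prolong T (lsubmx z)) (row_mx (new_a z) (new_b z)%:M).

(** The consequences of fibre-affinity that make the lift smooth with a nonvanishing Jacobian. *)
Hypothesis symbol_diag : forall k j, (k <= r)%N -> P j -> symbol k k j != 0.
Hypothesis new_t_t : forall j, P j -> partial 0 (@new_t K r T) j != 0.
Hypothesis new_t_x : forall i j, (i <= r)%N -> P j -> partial (inord i.+1) (@new_t K r T) j = 0.

Lemma symbol_gt k i j : (k < i)%N -> (i <= r)%N -> symbol k i j = 0.
Proof.
by move=> ki ir; rewrite /symbol (partial_indep (@depends_new_x _ r T k)) // inordK.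
Qed.

Lemma det_symbol_mx j : P j -> \det (symbol_mx j) != 0.
Proof.
move=> Pj; rewrite det_trig; last first.
  by apply/is_trig_mxP => k i ki; rewrite mxE symbol_gt // ltnW.
by apply/prodf_neq0 => i _; rewrite mxE symbol_diag // ltnW.
Qed.

Lemma open_prolong : open P. Proof. exact: open_prolong_dom. Qed.

Lemma open_joint_dom : open joint_dom.
Proof. by have [] := smooth_lsubmx (r + 1)%N open_prolong (smooth_coord open_prolong 0). Qed.

Lemma smooth_jet (f : jet -> K) : smooth_on P f -> smooth_on joint_dom (f \o lsubmx).
Proof. by move=> sf; have [] := smooth_lsubmx (r + 1)%N open_prolong sf. Qed.

Lemma smooth_symbol k i : smooth_on P (symbol k i).
Proof. by apply: smooth_partial; exact: smooth_new_x. Qed.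

(** Cramer's rule: the determinant does not vanish, and the cofactors are determinants of smooth
    entries. *)
Lemma smooth_inv_symbol l k : smooth_on P (fun j => invmx (symbol_mx j) l k).
Proof.
apply: (smooth_on_eq open_prolong (f := (fun j => (\det (symbol_mx j))^-1) \* (fun j => \adj
  (symbol_mx j) l k))).
  by move=> j Pj; rewrite /invmx unitmxE unitfE det_symbol_mx //= [RHS]mxE.
have sdet : smooth_on P (fun j => \det (symbol_mx j)).
  by apply: (smooth_det open_prolong) => a b; apply: (smooth_on_eq open_prolong (f := symbol a
    b)) => [j _|]; [rewrite mxE|exact: smooth_symbol].
apply: (smooth_mul open_prolong (smooth_inv open_prolong det_symbol_mx sdet)).
apply: (smooth_on_eq open_prolong (f := cst ((-1) ^+ (k + l)) \* (fun j => \det (row' k (col' l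
  (symbol_mx j)))))).
  by move=> j _; rewrite [RHS]mxE.
apply: (smooth_mul open_prolong (smooth_cst open_prolong _));
  apply: (smooth_det open_prolong) => a b.
by apply: (smooth_on_eq open_prolong (f := symbol (lift k a) (lift l b))) => [j _|];
  [rewrite !mxE|exact: smooth_symbol].
Qed.

Lemma smooth_new_a k : smooth_on joint_dom (fun z => new_a z 0 k).
Proof.
have oJ := open_joint_dom.
apply: (smooth_on_eq oJ (f := fun z => \sum_l
  (symbol r r (lsubmx z) * z 0 (rshift r.+2 (lshift 1 l)) - symbol r l (lsubmx z)) * invmx
    (symbol_mx (lsubmx z)) l k)).
  by move=> z _; rewrite [RHS]mxE; apply: eq_bigr => l _; rewrite !mxE.
apply: (smooth_sum oJ) => l _.
apply: (smooth_mul oJ _ (smooth_jet (smooth_inv_symbol l k))).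
apply: (smooth_sub oJ _ (smooth_jet (smooth_symbol r l))).
exact: (smooth_mul oJ (smooth_jet (smooth_symbol r r)) (smooth_coord oJ _)).
Qed.

Lemma smooth_new_b : smooth_on joint_dom new_b.
Proof.
have oJ := open_joint_dom.
have sx k : smooth_on joint_dom (@jet_x K r k \o lsubmx).
  by apply: smooth_jet; exact: smooth_coord open_prolong _.
apply: (smooth_sub oJ).
  apply: (smooth_add oJ (smooth_jet (@smooth_new_x _ r T r))); apply: (smooth_sum oJ) => k _.
  exact: (smooth_mul oJ (smooth_new_a k) (smooth_jet (@smooth_new_x _ r T k))).
apply: (smooth_mul oJ (smooth_jet (smooth_symbol r r))); apply: (smooth_sub oJ).
  apply: (smooth_add oJ (sx r)); apply: (smooth_sum oJ) => k _.
  apply: (smooth_mul oJ _ (sx k)).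
  apply: (smooth_on_eq oJ (f := fun z => z 0 (rshift r.+2 (lshift 1 k))));
    last exact: smooth_coord.
  by move=> z _; rewrite !mxE.
apply: (smooth_on_eq oJ (f := fun z => z 0 (rshift r.+2 (rshift r 0)))); last exact: smooth_coord.
by move=> z _; rewrite !mxE.
Qed.

Lemma prolong_entry j (k : 'I_r.+2) : prolong T j 0 k = if val k is l.+1 then new_x T l j else
  new_t T j.
Proof. by rewrite mxE. Qed.

Lemma smooth_joint_map : smooth_on joint_dom joint_map.
Proof.
have oJ := open_joint_dom; apply/(smooth_rVP oJ) => k.
rewrite -(fintype.splitK k); case: (fintype.split k) => [{}k|{}k] /=.
  apply: (smooth_on_eq oJ (f := (fun j => prolong T j 0 k) \o lsubmx)).
    by move=> z _; rewrite /joint_map row_mxEl.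
  apply: smooth_jet; rewrite (_ : (fun _ => _) = if val k is l.+1 then new_x T l else new_t T);
    last first.
    by apply/funext => j; rewrite prolong_entry; case: (val k).
  case: (val k) => [|l]; last exact: smooth_new_x.
  by apply: (smooth_subset _ (@smooth_new_t _ r T)) => j [].
rewrite -(fintype.splitK k); case: (fintype.split k) => [{}k|{}k] /=.
  apply: (smooth_on_eq oJ (f := fun z => new_a z 0 k)); last exact: smooth_new_a.
  by move=> z _; rewrite /joint_map row_mxEr row_mxEl.
apply: (smooth_on_eq oJ (f := new_b)); last exact: smooth_new_b.
by move=> z _; rewrite /joint_map !row_mxEr mxE ord1 eqxx.
Qed.

(** Rows belong to old variables and columns to new ones. The matrix is block triangular, because
    the new jets do not involve the arbitrary elements and the new a does not involve b. *)
Lemma joint_jacobian z : joint_dom z -> \det (jacobian joint_map z) != 0.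
Proof.
move=> Jz; have Pz : P (lsubmx z) := Jz.
have JE i k := jacobianE i k (@smooth_joint_map [::] z Jz).
set M := jacobian joint_map z in JE *.
have dl : dlsubmx M = 0.
  apply/matrixP => i k; rewrite [LHS]mxE [LHS]mxE JE [RHS]mxE.
  by apply: partial_affine => h; rewrite /joint_map !row_mxEl lsubmx_shiftr mulr0 addr0.
(* The k-th transformed derivative has order at most k, and the new t does not involve any x^(i), so
   this block is triangular. *)
have ul : \det (ulsubmx M) != 0.
  have ulE i k : ulsubmx M i k = partial i (if val k is l.+1 then new_x T l else new_t T) (lsubmx
    z).
    rewrite mxE mxE JE -partial_lsubmx; congr (partial _ _ _); apply/funext => q.
    by rewrite /joint_map row_mxEl prolong_entry /=; case: (val k).
  rewrite -det_tr det_trig; last first.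
    apply/is_trig_mxP => k i ki; rewrite mxE ulE.
    have i0 : (0 < i)%N by exact: leq_ltn_trans ki.
    have i1 : (i.-1 <= r)%N by rewrite -ltnS prednK // -ltnS ltn_ord.
    have -> : i = inord (i.-1).+1 by apply/val_inj; rewrite /= inordK prednK.
    case: k ki => -[|k] hk /= ki; first exact: new_t_x.
    by apply: symbol_gt => //; rewrite -ltnS prednK.
  apply/prodf_neq0 => k _; rewrite mxE ulE; case: k => -[|k] hk /=.
    by rewrite (_ : Ordinal hk = 0) ?new_t_t //; exact/val_inj.
  rewrite (_ : Ordinal hk = inord k.+1); last by apply/val_inj; rewrite /= inordK.
  exact: symbol_diag.
have dr : \det (drsubmx M) != 0.
  set N := drsubmx M; have NE i k : N i k = partial (rshift r.+2 i) (fun z => row_mx (new_a z)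
    (new_b z)%:M 0 k) z.
    rewrite /N mxE mxE JE; congr (partial _ _ _); apply/funext => q.
    by rewrite /joint_map row_mxEr.
  have Ndl : dlsubmx N = 0.
    apply/matrixP => i k; rewrite [LHS]mxE [LHS]mxE NE [RHS]mxE.
    apply: partial_affine => h; rewrite !row_mxEl mulr0 addr0 /new_a.
    by rewrite !lsubmx_shiftr rsubmx_shiftr lsubmx_shiftr.
  (* [new_a] is affine in a, with the linear part c_rr a C^(-1). *)
  have Nul : ulsubmx N = symbol r r (lsubmx z) *: invmx (symbol_mx (lsubmx z)).
    apply/matrixP => i k; rewrite [LHS]mxE [LHS]mxE NE.
    apply: partial_affine => h; rewrite !row_mxEl /new_a.
    rewrite !lsubmx_shiftr rsubmx_shiftr lsubmx_shiftl scalerDr -addrA mulmxDl addrC.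
    rewrite -!scalemxAl -rowE; set X := _ *m _; set Y := invmx _.
    by clearbody X Y; rewrite !mxE addrC mulrCA.
  have Ndr : drsubmx N = (symbol r r (lsubmx z))%:M.
    apply/matrixP => i k; rewrite [LHS]mxE [LHS]mxE NE !ord1 [RHS]mxE eqxx.
    have sE (x : K) : (x%:M : 'M[K]_1) 0 0 = x by rewrite mxE eqxx mulr1n.
    apply: partial_affine => h; rewrite !row_mxEr !sE /new_b.
    have aE : new_a (h *: delta_mx 0 (rshift r.+2 (rshift r 0)) + z) = new_a z.
      by rewrite /new_a !lsubmx_shiftr rsubmx_shiftr lsubmx_shiftr.
    rewrite aE !lsubmx_shiftr !rsubmx_shiftr lsubmx_shiftr.
    have -> : (h *: delta_mx 0 0 + rsubmx (rsubmx z)) 0 0 = h + rsubmx (rsubmx z) 0 0.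
      by rewrite mxE mxE mxE !eqxx mulr1.
    have alg (A s X b' : K) : A - s * (X - (h + b')) = A - s * (X - b') + h * s by ring.
    by rewrite mulr1n alg.
  rewrite -[N]submxK Ndl det_ublock Nul Ndr detZ det_inv det_scalar mulf_neq0 //.
    by rewrite mulf_neq0 ?expf_neq0 ?invr_neq0 ?det_symbol_mx // symbol_diag.
  by rewrite expr1 symbol_diag.
by rewrite -[M]submxK dl det_ublock mulf_neq0.
Qed.

Definition joint_transformation := Transformation open_joint_dom smooth_joint_map joint_jacobian.

End Prolonged.

(** * The coefficients of the transformed equation and their uniqueness *)

Section TransformedCoefficients.
Variables (K : numFieldType) (r : nat).
Local Notation jet := 'rV[K]_(r.+2).
Local Notation point := 'rV[K]_2.
Local Notation joint := 'rV[K]_(r.+2 + (r + 1)).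
Implicit Types (j : jet) (p : point) (z : joint) (a : 'rV[K]_r).
Variables (T : transformation K 2) (U : set point) (I : set K) (tau X1 X0 : K -> K).
Hypotheses (r0 : (0 < r)%N) (oU : open U) (UT : U `<=` tr_dom T) (oI : open I).
Hypotheses (stau : smooth1_on I tau) (sX1 : smooth1_on I X1) (sX0 : smooth1_on I X0).
Hypothesis (nz : forall t, I t -> derive1 tau t * X1 t != 0).
Hypothesis (rep : forall p, U p ->
  [/\ I (tvar p), tvar (T p) = tau (tvar p) & xvar (T p) = X1 (tvar p) * xvar p + X0 (tvar p)]).
Local Notation W := (@base K r @^-1` U).
Local Notation xc := (xcoef tau X1).
Local Notation cc := (ccoef tau X0).

Definition xcoef_mx t : 'M[K]_r := \matrix_(k < r, i < r) xc k i t.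
(** The lifted coefficients as functions of t, with the jet eliminated. *)
Definition trans_a t a : 'rV[K]_r := (xc r r t *: a - \row_i xc r i t) *m invmx (xcoef_mx t).
Definition trans_b t a (b : K) : K := cc r t + \sum_(k < r) trans_a t a 0 k * cc k t + xc r r t *
  b.

Lemma xcoef_mx_unit t : I t -> xcoef_mx t \in unitmx.
Proof.
move=> It; rewrite unitmxE unitfE det_trig; last first.
  by apply/is_trig_mxP => k i ki; rewrite mxE xcoef_gt.
by apply/prodf_neq0 => i _; rewrite mxE; exact: (xcoef_diag nz).
Qed.

Lemma trans_aK t a : I t -> trans_a t a *m xcoef_mx t = xc r r t *: a - \row_i xc r i t.
Proof. by move=> It; rewrite mulmxKV // xcoef_mx_unit. Qed.

Lemma new_x_lt k j : (k < r)%N -> W j ->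
  new_x T k j = \sum_(i < r) xc k i (jet_t j) * jet_x i j + cc k (jet_t j).
Proof.
move=> kr Wj; rewrite (new_x_affine oU oI stau sX1 sX0 nz rep (ltnW kr) Wj); congr (_ + _).
rewrite (big_ord_widen r (fun i => xc k i (jet_t j) * jet_x i j) kr) big_mkcond.
apply: eq_bigr => i _; case: ifP => //; rewrite ltnS leqNgt => /negbFE ki.
by rewrite xcoef_gt // mul0r.
Qed.

Lemma new_x_top j : W j -> new_x T r j =
  \sum_(i < r) xc r i (jet_t j) * jet_x i j + xc r r (jet_t j) * jet_x r j + cc r (jet_t j).
Proof.
move=> Wj; rewrite (new_x_affine oU oI stau sX1 sX0 nz rep (leqnn r) Wj); congr (_ + _).
by rewrite big_ord_recr.
Qed.

(** [a] and [a'] are arbitrary here: the transformed coefficients make the sum over x^(i) vanish,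
    and conversely its vanishing determines [a']. *)
Lemma pullback_equation j a' (a : 'rV[K]_r) : W j ->
  new_x T r j + \sum_(k < r) a' 0 k * new_x T k j =
  \sum_(i < r) ((a' *m xcoef_mx (jet_t j)) 0 i + xc r i (jet_t j) - xc r r (jet_t j) * a 0 i) *
    jet_x i j
  + xc r r (jet_t j) * (jet_x r j + \sum_(i < r) a 0 i * jet_x i j)
  + (cc r (jet_t j) + \sum_(k < r) a' 0 k * cc k (jet_t j)).
Proof.
move=> Wj; rewrite new_x_top //; set t := jet_t j.
have -> : \sum_(k < r) a' 0 k * new_x T k j =
  \sum_(i < r) (a' *m xcoef_mx t) 0 i * jet_x i j + \sum_(k < r) a' 0 k * cc k t.
  under eq_bigr => k _ do rewrite new_x_lt // mulrDr.
  rewrite big_split /=; congr (_ + _).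
  under eq_bigr => k _ do rewrite mulr_sumr.
  rewrite exchange_big; apply: eq_bigr => i _; rewrite mxE mulr_suml; apply: eq_bigr => k _.
  by rewrite mxE mulrA.
under [X in _ = X + _ + _]eq_bigr => i _ do rewrite mulrBl mulrDl -mulrA.
rewrite sumrB big_split /= -mulr_sumr.
have alg (S1 S2 S3 S4 c c' x : K) :
  S2 + c * x + c' + (S1 + S4) = S1 + S2 - c * S3 + c * (x + S3) + (c' + S4) by ring.
exact: alg.
Qed.

Lemma new_aE z : W (lsubmx z) -> new_a T z = trans_a (jet_t (lsubmx z)) (lsubmx (rsubmx z)).
Proof.
move=> Wz; have sE k i : (k <= r)%N -> (i <= r)%N -> symbol T k i (lsubmx z) = xc k i (jet_t
  (lsubmx z)).
  by move=> kr ir; exact: (partial_new_x oU oI stau sX1 sX0 nz rep kr ir Wz).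
rewrite /new_a /trans_a sE //; congr ((_ - _) *m invmx _).
  by apply/rowP => i; rewrite !mxE sE // ltnW.
by apply/matrixP => k i; rewrite !mxE sE // ltnW.
Qed.

Lemma new_bE z : W (lsubmx z) ->
  new_b T z = trans_b (jet_t (lsubmx z)) (lsubmx (rsubmx z)) (rsubmx (rsubmx z) 0 0).
Proof.
move=> Wz; have It : I (jet_t (lsubmx z)) := lifted_time rep Wz.
rewrite /new_b new_aE // (pullback_equation _ (lsubmx (rsubmx z)) Wz) trans_aK //.
rewrite big1 => [|i _]; last by rewrite !mxE subrK subrr mul0r.
rewrite /trans_b (_ : symbol T r r _ = xc r r (jet_t (lsubmx z))); last first.
  exact: (partial_new_x oU oI stau sX1 sX0 nz rep (leqnn r) (leqnn r) Wz).
set S := \sum_(i < r) _ * jet_x i _; set c := xc r r _.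
have alg (d x s A b : K) : 0 + d * (x + s) + A - d * (x + s - b) = A + d * b by ring.
exact: alg.
Qed.

(** The residuals of the two equations differ by the nonzero factor c_rr. *)
Lemma trans_equation j a b : W j ->
  (new_x T r j + \sum_(k < r) trans_a (jet_t j) a 0 k * new_x T k j = trans_b (jet_t j) a b)
  <-> jet_x r j + \sum_(i < r) a 0 i * jet_x i j = b.
Proof.
move=> Wj; have It : I (jet_t j) := lifted_time rep Wj.
rewrite (pullback_equation _ a Wj) trans_aK // big1 => [|i _];
  last by rewrite !mxE subrK subrr mul0r.
rewrite add0r addrC /trans_b; split=> [/addrI/mulfI|->//].
by apply; exact: (xcoef_diag nz).
Qed.

(** On the solutions over t the pulled-back equation is an affine relation between the independent
    coordinates x, ..., x^(r-1), so all its coefficients vanish. Only x is confined, to the values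
    that [U] admits. *)
Lemma trans_unique p a b a' b' : U p ->
  (forall j, W j -> jet_t j = tvar p -> jet_x r j + \sum_(i < r) a 0 i * jet_x i j = b ->
     new_x T r j + \sum_(k < r) a' 0 k * new_x T k j = b') ->
  a' = trans_a (tvar p) a /\ b' = trans_b (tvar p) a b.
Proof.
move=> Up H; set t := tvar p; have It : I t by have [] := rep Up.
(* The coefficients of that relation: [e i] belongs to x^(i), and [e'] is the constant term. *)
pose e i := (a' *m xcoef_mx t) 0 i + xc r i t - xc r r t * a 0 i.
pose e' := cc r t + \sum_(k < r) a' 0 k * cc k t + xc r r t * b - b'.
have key (y : nat -> K) : U (mkpoint t (y 0%N)) -> \sum_(i < r) e i * y i + e' = 0.
  move=> Uy; pose j := mkjet r t (fun i => if i == r then b - \sum_(i < r) a 0 i * y i else y i).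
  have jt : jet_t j = t by exact: jet_t_mkjet.
  have jx i : (i < r)%N -> jet_x i j = y i.
    by move=> ir; rewrite jet_x_mkjet 1?ltnW // ltn_eqF.
  have jr : jet_x r j = b - \sum_(i < r) a 0 i * y i by rewrite jet_x_mkjet // eqxx.
  have Wj : W j.
    rewrite /= (_ : base j = mkpoint t (y 0%N)) //; apply: base_mkjet; rewrite ?tvar_mkpoint //.
    by rewrite xvar_mkpoint ltn_eqF.
  have sj : jet_x r j + \sum_(i < r) a 0 i * jet_x i j = b.
    by under eq_bigr => i _ do rewrite jx //; rewrite jr subrK.
  have := H j Wj jt sj; rewrite (pullback_equation _ a Wj) jt sj.
  under eq_bigr => i _ do rewrite jx //.
  move=> E; rewrite /e' -E; have alg (A B c : K) : A + (B + c - (A + c + B)) = 0 by ring.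
  exact: alg.
have /nbhs_ballP[d /= d0 dU] : nbhs p U by exact: open_nbhs_nbhs.
have Ux h : `|h| < d -> U (mkpoint t (xvar p + h)).
  move=> hd; apply/dU/ball_point; rewrite tvar_mkpoint xvar_mkpoint.
  split=> //; split; first exact: ballxx.
  by rewrite -ball_normE /= opprD addrA subrr sub0r normrN.
pose i0 := Ordinal r0.
(* A second admissible value of x, which separates [e i0] from the constant term. *)
pose d2 := d / 2; have d2n : d2 != 0 by rewrite mulf_neq0 ?gt_eqF // invr_gt0.
have d2d : `|d2| < d.
  by rewrite /d2 normrM normfV !ger0_norm ?ltW // ltr_pdivrMr // ltr_pMr // ltr1n.
pose y0 x i : K := if i == 0%N then x else 0.
have sum0 x : \sum_(i < r) e i * y0 x i = e i0 * x.
  rewrite (bigD1 i0) //= big1 ?addr0 // => i; rewrite -val_eqE /= /y0 => /negbTE ->.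
  by rewrite mulr0.
have U0 : U (mkpoint t (xvar p)) by rewrite mkpoint_eta.
have k0 := key (y0 (xvar p)) U0; have k1 := key (y0 (xvar p + d2)) (Ux _ d2d).
rewrite !sum0 in k0 k1.
have e00 : e i0 = 0.
  apply: (mulIf d2n); rewrite mul0r -[RHS](subrr 0) -{1}k1 -k0; ring.
have e'0 : e' = 0 by rewrite e00 mul0r add0r in k0.
have ei i : e i = 0.
  have [->//|ii0] := eqVneq i i0.
  pose y n : K := if n == 0%N then xvar p else if n == i then 1 else 0.
  have := key y U0; rewrite e'0 addr0 (bigD1 i) //= big1 => [|l li].
    rewrite addr0 /y eqxx (_ : (val i == 0%N) = false) ?mulr1 //.
    by apply/negbTE; apply: contra ii0 => /eqP ii; apply/eqP/val_inj.
  have [->|l0] := eqVneq l i0; first by rewrite e00 mul0r.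
  rewrite /y (_ : (val l == 0%N) = false); last first.
    by apply/negbTE; apply: contra l0 => /eqP ll; apply/eqP/val_inj.
  by rewrite (_ : (val l == i) = false) ?mulr0 //; exact: negbTE.
have aE : a' *m xcoef_mx t = xc r r t *: a - \row_i xc r i t.
  apply/rowP => i; rewrite !mxE; apply/eqP; rewrite -subr_eq0 opprB addrA; apply/eqP.
  by have := ei i; rewrite /e mxE.
have a'E : a' = trans_a t a by rewrite /trans_a -aE mulmxK // xcoef_mx_unit.
split=> //; apply/esym/eqP; rewrite -subr_eq0 /trans_b -a'E; apply/eqP; exact: e'0.
Qed.

End TransformedCoefficients.

(** * Lifting fibre-affine transformations to equivalence transformations *)

Section Equivalence.
Variables (R : realType) (K : numFieldType) (rf : real_form R K) (r : nat).
Hypothesis r0 : (0 < r)%N.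
Local Notation jet := 'rV[K]_(r.+2).
Local Notation point := 'rV[K]_2.
Local Notation lifted U := (@base K r @^-1` U).
Implicit Types (j : jet) (p : point).

Lemma satisfies_prolong (T : transformation K 2) (E : linear_ode K r) j :
  satisfies E (prolong T j) <->
  new_x T r j + \sum_(i < r) ode_a E i (new_t T j) * new_x T i j = ode_b E (new_t T j).
Proof.
rewrite /satisfies; have -> : jet_t (prolong T j) = new_t T j by rewrite /jet_t mxE.
have px i : (i <= r)%N -> jet_x i (prolong T j) = new_x T i j.
  by move=> ir; rewrite /jet_x mxE /= inordK.
by rewrite px //; under eq_bigr => i _ do rewrite px ?(ltnW (ltn_ord i)) //.
Qed.

Definition a_row (E : linear_ode K r) t : 'rV[K]_r := \row_i ode_a E i t.

Lemma satisfies_row (E : linear_ode K r) j :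
  satisfies E j <-> jet_x r j + \sum_(i < r) a_row E (jet_t j) 0 i * jet_x i j = ode_b E (jet_t
    j).
Proof. by rewrite /satisfies; under [in X in _ <-> X]eq_bigr => i _ do rewrite mxE. Qed.

Section Construction.
Variables (T : transformation K 2) (fT : fibre_affine T).

Lemma fibre_affine_rep p : tr_dom T p -> exists (U : set point) (I : set K) (tau X1 X0 : K -> K),
  [/\ [/\ open U, U p & U `<=` tr_dom T], open I,
      [/\ smooth1_on I tau, smooth1_on I X1 & smooth1_on I X0],
      forall t, I t -> derive1 tau t * X1 t != 0
    & forall q, U q ->
        [/\ I (tvar q), tvar (T q) = tau (tvar q) & xvar (T q) = X1 (tvar q) * xvar q + X0 (tvar
          q)]].
Proof.
move=> Tp; have [U [I [tau [X1 [X0 [[oU Up] oI s nz rep]]]]]] := fT Tp.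
exists (U `&` tr_dom T), I, tau, X1, X0; split=> //.
  by split; [apply: openI => //; exact: open_tr_dom|split|move=> q []].
by move=> q [Uq _]; exact: rep.
Qed.

Lemma fibre_symbol_diag k j : (k <= r)%N -> prolong_dom T j -> symbol T k k j != 0.
Proof.
move=> kr [Tj _]; have [U [I [tau [X1 [X0 [[oU Uj UT] oI [st s1 s0] nz rep]]]]]] :=
  fibre_affine_rep Tj.
rewrite /symbol (partial_new_x oU oI st s1 s0 nz rep kr kr Uj).
exact: (xcoef_diag nz k (lifted_time rep Uj)).
Qed.

Lemma fibre_new_t_t j : prolong_dom T j -> partial 0 (@new_t K r T) j != 0.
Proof.
move=> [Tj _]; have [U [I [tau [X1 [X0 [[oU Uj UT] oI [st s1 s0] nz rep]]]]]] := fibre_affine_rep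
  Tj.
exact: (partial_new_t_t oU st nz rep Uj).
Qed.

Lemma fibre_new_t_x i j : (i <= r)%N -> prolong_dom T j -> partial (inord i.+1) (@new_t K r T) j
  = 0.
Proof.
move=> ir [Tj _]; have [U [I [tau [X1 [X0 [[oU Uj UT] oI [st s1 s0] nz rep]]]]]] :=
  fibre_affine_rep Tj.
exact: (partial_new_t_x oU rep ir Uj).
Qed.

Definition lift_transformation := joint_transformation fibre_symbol_diag fibre_new_t_t
  fibre_new_t_x.

Lemma lift_projects : projects_to lift_transformation T.
Proof. by split=> // z _; rewrite /= /joint_map row_mxKl. Qed.

Lemma lift_arbitrary (E E' : linear_ode K r) j :
  let z := row_mx j (arbitrary_elements E (jet_t j)) in
  new_a T z = a_row E' (new_t T j) -> new_b T z = ode_b E' (new_t T j) ->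
  rsubmx (lift_transformation z) = arbitrary_elements E' (new_t T j).
Proof. by move=> z az bz; rewrite /= /joint_map row_mxKr -/z az bz. Qed.

Lemma lsub_arbitrary (E : linear_ode K r) j t : lsubmx (rsubmx (row_mx j (arbitrary_elements E
  t))) = a_row E t.
Proof. by rewrite row_mxKr row_mxKl. Qed.

Lemma rsub_arbitrary (E : linear_ode K r) j t :
  rsubmx (rsubmx (row_mx j (arbitrary_elements E t))) 0 0 = ode_b E t.
Proof. by rewrite row_mxKr row_mxKr mxE eqxx. Qed.

(** The lift yields the image coefficients as functions of the old t; as coefficients of an equation
    they have to be functions of the new one, hence the local inverse of tau and the neighbourhood
    of [p]. *)
Lemma lift_equivalence : equivalence_transformation lift_transformation.
Proof.
exists T; split; first exact: lift_projects.
move=> E p Tp Ep.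
have [U0 [I0 [tau [X1 [X0 [[oU Up UT] oI [st s1 s0] nz rep]]]]]] := fibre_affine_rep Tp.
have /nbhs_ballP[e /= e0 eU] : nbhs p U0 by exact: open_nbhs_nbhs.
pose x0 := xvar p.
(* Times at which [E] is defined and the line x = [x0] runs inside [U0]. *)
pose I1 := ball (tvar p) e `&` ode_dom E.
have oE : open (ode_dom E) := @ode_dom_open _ _ E.
have oI1 : open I1 by apply: openI => //; exact: ball_open.
have I1U t : I1 t -> U0 (mkpoint t x0).
  move=> [bt _]; apply/eU/ball_point; rewrite tvar_mkpoint xvar_mkpoint.
  by do !split => //; exact: ballxx.
have I10 t : I1 t -> I0 t.
  by move=> /I1U/rep[]; rewrite tvar_mkpoint.
have I1p : I1 (tvar p) by split => //; exact: ballxx.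
have [I' [J [s [oI' I'p oJ ss [I'I1 I'J JI']]]]] :=
  local_inverse rf oI1 I1p (smooth1_sub I10 st) (fun t It => dtau_neq0 nz (I10 t It)).
(* Over this set the new time determines t. *)
pose U := ball p e `&` [set q | I' (tvar q)].
have oUU : open U.
  apply: openI; first exact: ball_open.
  apply: (@open_comp _ _ (fun q : point => q 0 0)) => // q _; exact: coord_continuous.
have UU0 : U `<=` U0 by move=> q [/eU].
(* A jet over the time s(y) that varies smoothly with y. Its other entries do not affect the lifted
   coefficients, as long as it lies over [U0]. *)
pose g0 y : jet := mkjet r (s y) (fun k => if k == 0%N then x0 else 0).
pose g y := row_mx (g0 y) (arbitrary_elements E (s y)).
have JI1 y : J y -> I1 (s y) by move=> /JI'[/I'I1].
have g0U y : J y -> U0 (base (g0 y)).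
  move=> /JI1/I1U; rewrite (_ : base (g0 y) = mkpoint (s y) x0) //.
  by apply: base_mkjet; rewrite ?tvar_mkpoint ?xvar_mkpoint.
have gdom y : J y -> @joint_dom K r T (g y).
  move=> Jy; rewrite /joint_dom /= row_mxKl.
  exact: (lifted_prolong_dom oU UT st nz rep (g0U y Jy)).
have sg k : smooth1_on J (fun y => g y 0 k).
  rewrite -(fintype.splitK k); case: (fintype.split k) => [{}k|{}k] /=.
    apply: (smooth1_eq oJ (f := if val k is l.+1 then cst (if l == 0%N then x0 else 0) else s)).
      by move=> y _; rewrite /g row_mxEl mxE; case: (val k).
    by case: (val k) => [|l]; [exact: ss|exact: (smooth1_cst oJ)].
  rewrite -(fintype.splitK k); case: (fintype.split k) => [{}k|{}k] /=.
    apply: (smooth1_eq oJ (f := ode_a E k \o s)).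
      by move=> y _; rewrite /g row_mxEr row_mxEl mxE.
    apply: (smooth1_comp1 oJ oE) => //; last exact: ode_a_smooth.
    by move=> y /JI1[].
  apply: (smooth1_eq oJ (f := ode_b E \o s)).
    by move=> y _; rewrite /g !row_mxEr mxE ord1 eqxx.
  apply: (smooth1_comp1 oJ oE) => //; last exact: ode_b_smooth.
  by move=> y /JI1[].
have oJD := @open_joint_dom K r T.
have sa i : smooth1_on J (fun y => new_a T (g y) 0 i).
  exact: (smooth1_comp oJ gdom (smooth_new_a fibre_symbol_diag i) sg).
have sb : smooth1_on J (fun y => new_b T (g y)).
  exact: (smooth1_comp oJ gdom (smooth_new_b fibre_symbol_diag) sg).
pose E' := LinearODE oJ sa sb.
have gE y : J y -> a_row E' y = trans_a tau X1 (s y) (a_row E (s y)) /\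
    ode_b E' y = trans_b tau X1 X0 (s y) (a_row E (s y)) (ode_b E (s y)).
  move=> Jy; have WJ : U0 (base (lsubmx (g y))) by rewrite row_mxKl; exact: g0U.
  have tE : jet_t (lsubmx (g y)) = s y by rewrite row_mxKl jet_t_mkjet.
  split.
    have <- : new_a T (g y) = trans_a tau X1 (s y) (a_row E (s y)).
      by rewrite (new_aE oU oI st s1 s0 nz rep WJ) tE lsub_arbitrary.
    by apply/rowP => i; rewrite mxE.
  by rewrite /= (new_bE oU oI st s1 s0 nz rep WJ) tE lsub_arbitrary rsub_arbitrary.
have target j : U (base j) -> J (new_t T j) /\ s (new_t T j) = jet_t j.
  move=> Uj; have [_ Ij] := Uj; have [_ nt _] := rep _ (UU0 _ Uj).
  by have := I'J _ Ij; rewrite /new_t nt tvar_base.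
have main j : U (base j) ->
    a_row E' (new_t T j) = trans_a tau X1 (jet_t j) (a_row E (jet_t j)) /\
    ode_b E' (new_t T j) = trans_b tau X1 X0 (jet_t j) (a_row E (jet_t j)) (ode_b E (jet_t j)).
  by move=> /target[/gE + sE]; rewrite sE.
exists U, E'; split => //.
- by split; [exact: ballxx|].
- by move=> q /UU0/UT.
split; first split.
- move=> q [bq Iq]; have [_ ->  _] := rep _ (eU _ bq); split; last by have [] := I'J _ Iq.
  by have [] := I'I1 _ Iq.
- move=> j Uj Pj; have [aE bE] := main j Uj; have W0 := UU0 _ Uj.
  rewrite satisfies_prolong satisfies_row bE.
  rewrite -(trans_equation oU oI st s1 s0 nz rep (a_row E (jet_t j)) (ode_b E (jet_t j)) W0) -aE.
  by under [in X in _ <-> X]eq_bigr => i _ do rewrite -[ode_a E' i _]/((fun k => ode_a E' k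
    (new_t T j)) i);
  under [in X in X <-> _]eq_bigr => i _ do rewrite mxE.
move=> j Uj Pj; have [aE bE] := main j Uj.
have WJ : U0 (base (lsubmx (row_mx j (arbitrary_elements E (jet_t j))))) by rewrite row_mxKl;
  exact: UU0.
apply: lift_arbitrary.
  by rewrite (new_aE oU oI st s1 s0 nz rep WJ) lsub_arbitrary row_mxKl.
by rewrite (new_bE oU oI st s1 s0 nz rep WJ) lsub_arbitrary rsub_arbitrary row_mxKl.
Qed.

End Construction.
End Equivalence.

(** * Normalization *)

Section Final.
Variables (R : realType) (K : numFieldType) (rf : real_form R K) (r : nat).
Hypothesis r3 : (3 <= r)%N.
Local Notation jet := 'rV[K]_(r.+2).
Local Notation point := 'rV[K]_2.
Implicit Types (j : jet) (p : point).

Let r0 : (0 < r)%N. Proof. exact: leq_trans r3. Qed.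

(** The lift is built from [T] without reference to [E']; that it carries the coefficients of [E] to
    those of [E'] is the uniqueness in [trans_unique], applied at each jet. *)
Lemma linear_ode_normalized : normalized K r.
Proof.
move=> E E' T TE.
have fT : fibre_affine T by exact: (maps_ode_fibre_affine rf r3 (@open_tr_dom _ T) (fun p Tp =>
  Tp) TE).
exists (lift_transformation r fT); split.
- exact: (lift_equivalence rf).
- exact: lift_projects.
split=> // j Tj Pj; have [dE Eeq] := TE.
have [U [I [tau [X1 [X0 [[oU Uj UT] oI [st s1 s0] nz rep]]]]]] := fibre_affine_rep fT Tj.
(* Jets over [U] with the same t share the new time, so they meet the same coefficients of [E']. *)
have nt j' : U (base j') -> new_t T j' = tau (jet_t j').
  by move=> /rep[_ + _]; rewrite /new_t tvar_base.
set t := jet_t j.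
have [aE bE] : a_row E' (new_t T j) = trans_a tau X1 (tvar (base j)) (a_row E t) /\
    ode_b E' (new_t T j) = trans_b tau X1 X0 (tvar (base j)) (a_row E t) (ode_b E t).
  apply: (trans_unique r0 oU oI st s1 s0 nz rep Uj) => j' Wj'; rewrite tvar_base => tj sat.
  have Pj' : prolong_dom T j' := lifted_prolong_dom oU UT st nz rep Wj'.
  have [+ _] := Eeq j' (UT _ Wj') Pj'; rewrite satisfies_row tj => /(_ sat).
  rewrite satisfies_prolong (nt _ Wj') (nt _ Uj) tj => <-.
  by congr (_ + _); apply: eq_bigr => i _; rewrite mxE.
have WJ : U (base (lsubmx (row_mx j (arbitrary_elements E t)))) by rewrite row_mxKl.
apply: lift_arbitrary.
  by rewrite (new_aE oU oI st s1 s0 nz rep WJ) lsub_arbitrary row_mxKl aE tvar_base.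
by rewrite (new_bE oU oI st s1 s0 nz rep WJ) lsub_arbitrary rsub_arbitrary row_mxKl bE tvar_base.
Qed.

(** [equivalence_transformation] comes with a projection of its own, which has to be identified with
    the given one. [Phi] sees a point only through a jet over it in the prolongation domain, so such
    a jet must be found. *)
Lemma projects_to_eq (Phi : transformation K (r.+2 + (r + 1))) (T T' : transformation K 2) :
  projects_to Phi T -> projects_to Phi T' -> forall p, tr_dom T p -> tr_dom T' p /\ T p = T' p.
Proof.
move=> [domT mapT] [domT' mapT'] p Tp.
have [j [bj Pj]] : exists j : jet, base j = p /\ prolong_dom T j.
  pose j y : jet := mkjet r (tvar p) (fun k => if k == 0%N then xvar p else y).
  have bj y : base (j y) = p by exact: base_mkjet.
  have jx y : jet_x 1 (j y) = y by rewrite jet_x_mkjet.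
  (* T_t and T_x do not both vanish, so D T = T_t + x' T_x is nonzero for x' = 0 or for x' = 1. *)
  have [tx0|tx0] := eqVneq (partial 0 (t_comp T) p) 0; last first.
    by exists (j 0); split=> //; split; rewrite ?bj // D_new_t ?bj // jx mul0r addr0.
  exists (j 1); split=> //; split; rewrite ?bj // D_new_t ?bj // jx mul1r tx0 add0r.
  by have := tr_jacobian Tp; rewrite jacobian_point // tx0 mul0r sub0r oppr_eq0;
    apply: contra_neq => ->; rewrite mulr0.
pose z : 'rV[K]_(r.+2 + (r + 1)) := row_mx j 0.
have Dz : tr_dom Phi z by apply/domT; rewrite row_mxKl.
have Pj' : prolong_dom T' j by move/domT': Dz; rewrite row_mxKl.
have jj : prolong T j = prolong T' j.
  by have := mapT _ Dz; rewrite (mapT' _ Dz) row_mxKl.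
split; first by rewrite -bj; case: Pj'.
rewrite -bj; apply: pointP.
  by have := congr1 (fun q : jet => q 0 0) jj; rewrite !mxE.
by have := congr1 (fun q : jet => q 0 (inord 1)) jj; rewrite !mxE /= inordK.
Qed.

Lemma equivalence_fibre_affine (Phi : transformation K (r.+2 + (r + 1))) (T : transformation K 2)
  :
  equivalence_transformation Phi -> projects_to Phi T -> fibre_affine T.
Proof.
move=> [T' [PT' eT']] PT p Tp.
have [T'p _] := projects_to_eq PT PT' Tp.
have s0 (i : 'I_r) : smooth1_on setT (fun _ : K => 0 : K) := @smooth1_cst K setT 0 openT.
(* The test equation x^(r) = 0, defined for all t, must have an image near every point; a single
   mapped equation already forces fibre-affinity. *)
pose E0 := LinearODE openT s0 (@smooth1_cst K setT 0 openT).
have [U [E' [oU Up UT' [TE _]]]] := eT' E0 p T'p I.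
have [U1 [I [tau [X1 [X0 [[oU1 U1p] oI s nz rep]]]]]] :=
  maps_ode_fibre_affine rf r3 oU UT' TE Up.
exists (U1 `&` tr_dom T), I, tau, X1, X0; split=> //.
  by split; [apply: openI => //; exact: open_tr_dom|split].
by move=> q [U1q Tq]; have [_ ->] := projects_to_eq PT PT' Tq; exact: rep.
Qed.

End Final.

Theorem proposition4 (R : realType) (K : numFieldType)
    (hK : real_or_complex R K) (r : nat) (hr : (3 <= r)%N) :
  (forall T : transformation K 2,
     (exists Phi : transformation K (r.+2 + (r + 1)),
        equivalence_transformation Phi /\ projects_to Phi T)
     <-> fibre_affine T)
  /\ normalized K r.
Proof.
have [rf] := real_form_exists hK; have r0 : (0 < r)%N by exact: leq_trans hr.
split; last exact: (linear_ode_normalized rf hr).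
move=> T; split=> [[Phi [eq PT]]|fT]; first exact: (equivalence_fibre_affine rf hr eq PT).
exists (lift_transformation r fT); split; first exact: (lift_equivalence rf).
exact: lift_projects.
Qed.
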